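(* Let $\mathcal{A}$ be an infinite and proper pattern avoidance class which is either sum-closed or difference-closed. For each $n$ let $\Pi_n$ be a uniformly random element of $\mathcal{S}_n$. Then there exists a constant $c_{\mathcal{A}}$ with $1 \leq c_{\mathcal{A}} < \infty$ such that $$\lim_{n\to\infty} \frac{\mathbf{E}\, L_{\mathcal{A}}(\Pi_n)}{\sqrt{n}} = 2\sqrt{c_{\mathcal{A}}}.$$
   Context: $\mathcal{S}_n$ is the set of permutations of $\{1,\dots,n\}$, written as sequences. The pattern of a finite sequence of distinct elements of a linearly ordered set is the permutation whose entries are in the same relative order as those of the sequence. A permutation $\sigma$ occurs as a pattern in (is involved in) $\pi$ if some subsequence of $\pi$ (not necessarily contiguous) has pattern $\sigma$; otherwise $\pi$ avoids $\sigma$. For a set $B$ of permutations, $\mathrm{Av}(B)$ is the set of all permutations avoiding every element of $B$; a pattern avoidance class is a set of the form $\mathrm{Av}(B)$. It is proper if it is not the set of all permutations, i.e. $B$ is non-empty. For a permutation $\pi$, $L_{\mathcal{A}}(\pi)$ is the maximum length of a subsequence of $\pi$ whose pattern belongs to $\mathcal{A}$. The direct sum $\alpha\oplus\beta$ of two permutations is the permutation $\alpha\beta'$ (concatenation) where $\beta'$ has pattern $\beta$ and each element of $\beta'$ is larger than all elements of $\alpha$. The direct difference $\alpha\ominus\beta$ is the permutation $\alpha'\beta$ where $\alpha'$ has pattern $\alpha$ and each element of $\alpha'$ is larger than all elements of $\beta$. A class $\mathcal{A}$ is sum-closed (respectively difference-closed) if $\alpha\oplus\beta\in\mathcal{A}$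 (respectively $\alpha\ominus\beta\in\mathcal{A}$) for all $\alpha,\beta\in\mathcal{A}$. *)

(* Defs.v *)
From HB Require Import structures.
From mathcomp Require Import all_boot all_order all_algebra.
From mathcomp Require Import all_classical all_reals all_analysis.

Set Implicit Arguments.
Unset Strict Implicit.
Unset Printing Implicit Defensive.

Import Order.TTheory GRing.Theory Num.Theory.
Import numFieldNormedType.Exports.

Local Open Scope classical_set_scope.

(* A permutation of {1, ..., n} is the sequence of its values; the empty
   sequence is the unique permutation of length 0. *)
Definition Sn (n : nat) : seq (seq nat) := permutations (iota 1 n).

Definition all_perms : set (seq nat) := [set s | exists n : nat, s \in Sn n].

(* Each entry is replaced by its rank, counted from 1. This is the pattern of
   [s] when the entries of [s] are distinct, the only case used. *)
Definition pattern_of (d : Order.disp_t) (T : orderType d) (s : seq T) :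
    seq nat :=
  [seq count (fun y => (y <= x)%O) s | x <- s].

Definition involved (sigma pi : seq nat) : Prop :=
  exists2 t : seq nat, subseq t pi & pattern_of t = sigma.

Definition Av (B : set (seq nat)) : set (seq nat) :=
  [set pi | all_perms pi /\ forall sigma, B sigma -> ~ involved sigma pi].

Definition avoidance_class (A : set (seq nat)) : Prop :=
  exists2 B : set (seq nat), B `<=` all_perms & A = Av B.

Definition proper_class (A : set (seq nat)) : Prop := A <> all_perms.

Definition direct_sum (a b : seq nat) : seq nat :=
  a ++ [seq size a + x | x <- b]%N.

Definition direct_difference (a b : seq nat) : seq nat :=
  [seq size b + x | x <- a]%N ++ b.

Definition sum_closed (A : set (seq nat)) : Prop :=
  forall a b, A a -> A b -> A (direct_sum a b).

Definition difference_closed (A : set (seq nat)) : Prop :=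
  forall a b, A a -> A b -> A (direct_difference a b).

(* The subsequences of [pi] are the [mask m pi], [m] selecting positions. *)
Definition longest (A : set (seq nat)) (pi : seq nat) : nat :=
  \max_(m : (size pi).-tuple bool | `[< A (pattern_of (mask m pi)) >])
     size (mask m pi).

Local Open Scope ring_scope.

(* Expectation of [f Pi_n] for [Pi_n] uniform on the permutations of length
   [n]; [Sn n] is duplicate-free, of size n!. *)
Definition uniform_expectation (R : realType) (n : nat) (f : seq nat -> R) : R :=
  (\sum_(pi <- Sn n) f pi) / (size (Sn n))%:R.

(* Main.v *)
Require Import Defs.
From HB Require Import structures.
From mathcomp Require Import all_boot all_order all_algebra all_fingroup.
From mathcomp Require Import all_classical all_reals all_analysis.
From mathcomp Require Import zify ring lra.

(** Only four facts about the class are used: it is closed under patterns and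
    under direct sums, it contains the permutation of size 1, and it avoids some
    permutation. A difference-closed class has these properties after reversal of
    all sequences ([sum_closed_reversal]), which preserves the uniform law. Write
    [f n] for the mean of the longest length over the permutations of size [n].

    The limit exists. Cut the diagram of a random permutation of size [k * (k * n)]
    into [k * k] equal boxes. Each of the [k] diagonal boxes contains about [n]
    points, with variance at most [n], and given their number the pattern of these
    points is uniform ([sum_restrict_box]). Sum-closure allows one to concatenate
    the optimal subsequences of the diagonal boxes, so that [f (k * (k * n))] is at
    least about [k * f n] ([expect_super]). Hence [f n / sqrt n] is almost
    nondecreasing, and it converges if it is bounded ([scaled_cvg]).

    It is bounded. By the Marcus-Tardos theorem the class has at most [2 ^ (e * K)]
    elements of size [K] ([class_growth]). A random permutation of size [n] has
    ['C(n, K)] subsequences of length [K], each with a uniform pattern, so that for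
    [K] a large multiple of [sqrt n] it is unlikely that one of them has its pattern
    in the class ([expect_le]).

    The limit is at least 2. The class contains all increasing permutations, so this
    is the lower bound in Ulam's problem on increasing subsequences. The proof follows
    Cator and Groeneboom, on a grid instead of the Poisson process: mark each cell
    of an [a * b] grid independently with probability [p], and add sources with density
    [al] on the bottom side and sinks with density [be] on the left side. When
    [al * be = p * (1 - al) * (1 - be)] the increments of the last-passage function stay
    independent Bernoulli variables from row to row ([profile_stationary]), so that
    its mean at the far corner is exactly [a * al + b * be]. Now choose these
    parameters small with [a * al = b * be = s], hence [a * b * p ~ s ^ 2]. A maximal
    path follows one of the two sides up to a fraction [z] of it and then is a strictly
    increasing chain of marked cells in a rectangle that contains about
    [(1 - z) * s ^ 2] of them; when [f n <= kappa * sqrt n + C], such a chain has mean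
    length at most about [kappa * s * sqrt (1 - z)] ([mean_maxchain]). The lengths have
    small variances, so the mean of the maximum over [z] is about the maximum of
    the means, and [2 * s <= max_z (z * s + kappa * s * sqrt (1 - z)) <= s * (1 + kappa ^ 2 / 4)].
    Therefore [kappa >= 2] ([constant_ge2]).

    If [l] is the limit, the constant is [(l / 2) ^ 2]. *)

Set Implicit Arguments.
Unset Strict Implicit.
Unset Printing Implicit Defensive.

Import Order.TTheory GRing.Theory Num.Theory.
Import numFieldNormedType.Exports.

Local Open Scope nat_scope.

(** * Patterns and longest subsequences *)

Lemma size_pattern_of (s : seq nat) : size (pattern_of s) = size s.
Proof. exact: size_map. Qed.

Lemma pattern_of_eq (T : eqType) (v w : T -> nat) (q : seq T) :
  {in q &, forall i j, (v i <= v j) = (w i <= w j)} ->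
  pattern_of (map v q) = pattern_of (map w q).
Proof.
move=> vw; rewrite /pattern_of -!map_comp; apply/eq_in_map => x xq /=.
by rewrite !count_map; apply: eq_in_count => y yq /=; apply: vw.
Qed.

Lemma pattern_of_mono (g : nat -> nat) (s : seq nat) :
  {in s &, {mono g : x y / x <= y}} -> pattern_of (map g s) = pattern_of s.
Proof.
move=> gm; rewrite -[in RHS](map_id s).
by apply: pattern_of_eq => x y xs ys; rewrite gm.
Qed.

Definition rank (s : seq nat) (x : nat) := count (leq^~ x) s.

Lemma pattern_of_rank (s : seq nat) : pattern_of s = map (rank s) s.
Proof. by []. Qed.

Lemma rank_mono (s : seq nat) : {in s &, {mono rank s : x y / x <= y}}.
Proof.
move=> x y xs ys; apply/idP/idP; last first.
  by move=> xy; apply: sub_count => z /= /leq_trans; apply.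
apply: contraTT; rewrite -!ltnNge => yx.
have : count (predU (leq^~ y) (pred1 x)) s <= rank s x.
  by apply: sub_count => z /= /orP[/leq_trans->//|/eqP->//]; apply: ltnW.
apply: leq_trans; have := count_predUI (leq^~ y) (pred1 x) s.
rewrite (@eq_count _ (predI _ _) pred0); last first.
  by move=> z /=; case: (eqVneq z x) => [->|]; rewrite ?andbF// leqNgt yx.
by rewrite count_pred0 addn0 => ->; rewrite -addn1 leq_add2l -has_count has_pred1.
Qed.

(** Consequently [longest] takes the same value on a sequence and on its pattern,
    and a sequence of arbitrary distinct labels can stand for a permutation. *)
Lemma pattern_of_mask m (s : seq nat) :
  pattern_of (mask m (pattern_of s)) = pattern_of (mask m s).
Proof.
rewrite [X in mask m X]pattern_of_rank -map_mask pattern_of_mono// => x y xs ys.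
by apply: rank_mono; apply: mem_mask; [exact: xs|exact: ys].
Qed.

Lemma uniq_pattern_of (s : seq nat) : uniq s -> uniq (pattern_of s).
Proof.
move=> us; rewrite pattern_of_rank map_inj_in_uniq// => x y xs ys e.
by apply/eqP; rewrite eqn_leq -!(rank_mono xs ys, rank_mono ys xs) e leqnn.
Qed.

Lemma pattern_of_Sn (s : seq nat) : uniq s -> pattern_of s \in Sn (size s).
Proof.
move=> us; rewrite mem_permutations uniq_perm ?uniq_pattern_of ?iota_uniq//.
have [] // := @uniq_min_size _ (pattern_of s) (iota 1 (size s)) (uniq_pattern_of us);
  last by rewrite size_pattern_of size_iota.
move=> _ /mapP[x xs ->]; rewrite mem_iota add1n ltnS count_size andbT.
by rewrite -has_count; apply/hasP; exists x => /=.
Qed.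

Lemma Sn_uniq n s : s \in Sn n -> uniq s.
Proof. by rewrite mem_permutations => /perm_uniq->; exact: iota_uniq. Qed.

Lemma pattern_of_id n s : s \in Sn n -> pattern_of s = s.
Proof.
rewrite mem_permutations => p; rewrite /pattern_of -[RHS]map_id.
apply/eq_in_map => x; rewrite (perm_mem p) mem_iota add1n ltnS => /andP[x0 xn].
rewrite (seq.permP p) -(subnKC xn) iotaD count_cat.
rewrite (_ : count _ (iota 1 x) = count predT (iota 1 x)); last first.
  by apply: eq_in_count => y; rewrite mem_iota add1n ltnS leEnat => /andP[_ ->].
rewrite count_predT size_iota (_ : count _ _ = count pred0 (iota (1 + x) (n - x))).
  by rewrite count_pred0 addn0.
apply: eq_in_count => y; rewrite mem_iota => /andP[y1 _].
by apply/negbTE; rewrite -ltnNge.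
Qed.

Lemma pattern_of_cat (s t : seq nat) : (forall x y, x \in s -> y \in t -> x < y) ->
  pattern_of (s ++ t) = direct_sum (pattern_of s) (pattern_of t).
Proof.
move=> st; rewrite /direct_sum size_pattern_of /pattern_of map_cat.
rewrite -[X in _ = _ ++ X]map_comp; congr (_ ++ _); apply/eq_in_map => x xs /=.
  rewrite count_cat [X in _ + X](_ : _ = count pred0 t).
    by rewrite count_pred0 addn0.
  by apply: eq_in_count => y yt /=; apply/negbTE; rewrite -ltnNge; apply: st.
rewrite count_cat [X in X + _](_ : _ = count predT s) ?count_predT//.
by apply/eqP; rewrite -all_count; apply/allP => y ys /=; rewrite leEnat; apply: ltnW; apply: st.
Qed.

Lemma pattern_of_sorted (s : seq nat) : sorted ltn s -> pattern_of s = iota 1 (size s).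
Proof.
elim/last_ind: s => [//|s x IH] ss.
have us : pairwise ltn (rcons s x) by rewrite -(sorted_pairwise ltn_trans).
rewrite -cats1 pattern_of_cat; last first.
  move=> y z ys; rewrite inE => /eqP->.
  by move: us; rewrite pairwise_rcons => /andP[/allP/(_ _ ys)].
rewrite /direct_sum IH; last first.
  by move: us; rewrite pairwise_rcons => /andP[_]; rewrite (sorted_pairwise ltn_trans).
by rewrite size_iota size_cat iotaD /pattern_of /= lexx addn0 addnC.
Qed.

Lemma pattern_of_rev (s : seq nat) : pattern_of (rev s) = rev (pattern_of s).
Proof.
rewrite /pattern_of -map_rev; apply: eq_map => x; exact: count_rev.
Qed.

Section Longest.
Variable A : set (seq nat).

Lemma longest_ge s t :
  subseq t s -> A (pattern_of t) -> size t <= longest A s.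
Proof.
case/subseqP => m sm ->{t} At.
have sm' : size m == size s by apply/eqP.
rewrite /longest; apply: (@leq_bigmax_cond _ (fun m : (size s).-tuple bool =>
  `[< A (pattern_of (mask m s)) >]) (fun m => size (mask m s)) (Tuple sm')).
exact/asboolP.
Qed.

Lemma longest_size s : longest A s <= size s.
Proof.
apply/bigmax_leqP => m _; rewrite size_mask ?size_tuple//.
by rewrite -[X in _ <= X](size_tuple m) count_size.
Qed.

Hypothesis A0 : A [::].

Lemma longest_ex s :
  exists t : seq nat, [/\ subseq t s, A (pattern_of t) & size t = longest A s].
Proof.
have P0 : 0 < #|[pred m : (size s).-tuple bool | `[< A (pattern_of (mask m s)) >]]|.
  apply/card_gt0P; exists (nseq_tuple (size s) false); rewrite inE.
  by rewrite /= mask_false; apply/asboolP; apply/asboolP.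
have [m Pm e] := eq_bigmax_cond (fun m : (size s).-tuple bool => size (mask m s)) P0.
exists (mask m s); split; [exact: mask_subseq| exact/asboolP| by rewrite -e].
Qed.

Lemma longest_subseq s t : subseq s t -> longest A s <= longest A t.
Proof.
move=> st; have [u [us Au <-]] := longest_ex s.
exact: longest_ge (subseq_trans us st) Au.
Qed.

Lemma longest_pattern_of s : longest A (pattern_of s) = longest A s.
Proof.
apply/eqP; rewrite eqn_leq; apply/andP; split.
  have [t [/subseqP[m sm ->] At <-]] := longest_ex (pattern_of s).
  rewrite pattern_of_mask in At.
  rewrite [in X in X <= _]pattern_of_rank -map_mask size_map.
  exact: longest_ge (mask_subseq _ _) At.
have [t [/subseqP[m sm ->] At <-]] := longest_ex s.
rewrite -pattern_of_mask in At.
have := longest_ge (mask_subseq m (pattern_of s)) At.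
by rewrite [in X in X <= _ -> _]pattern_of_rank -map_mask size_map.
Qed.

Lemma longest_cat (s t : seq nat) : sum_closed A ->
  (forall x y, x \in s -> y \in t -> x < y) ->
  longest A s + longest A t <= longest A (s ++ t).
Proof.
move=> sumA st.
have [u [us Au <-]] := longest_ex s; have [v [vt Av <-]] := longest_ex t.
rewrite -size_cat; apply: longest_ge; first exact: cat_subseq.
rewrite pattern_of_cat; first exact: sumA.
by move=> x y /(mem_subseq us) xs /(mem_subseq vt) yt; apply: st.
Qed.

Lemma iota_in : sum_closed A -> A [:: 1] -> forall n, A (iota 1 n).
Proof.
move=> sumA A1; elim=> [//|n IH].
by rewrite -[n.+1]addn1 iotaD; have := sumA _ _ IH A1; rewrite /direct_sum size_iota /= addnC.
Qed.

End Longest.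

(** * Random permutations *)

Local Open Scope ring_scope.

(** The values are counted from 0; [oneline] below counts them from 1. *)
Definition word n (s : 'S_n) : seq nat := [seq val (s i) | i <- enum 'I_n].

Lemma size_word n (s : 'S_n) : size (word s) = n.
Proof. by rewrite size_map size_enum_ord. Qed.

Lemma uniq_word n (s : 'S_n) : uniq (word s).
Proof.
by rewrite map_inj_uniq ?enum_uniq// => i j /val_inj /perm_inj.
Qed.

Lemma map_nth_index (T : eqType) (q q' : seq T) : uniq q -> size q' = size q ->
  [seq nth x q' (index x q) | x <- q] = q'.
Proof.
case: q q' => [|x0 q] [|y0 q'] // uq sq'.
apply: (@eq_from_nth _ x0) => [|i]; rewrite size_map ?sq'// => iq.
by rewrite (nth_map x0)// index_uniq// (set_nth_default x0)// sq'.
Qed.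

Lemma uniq_tnth_inj (T : eqType) (q : seq T) : uniq q -> injective (tnth (in_tuple q)).
Proof.
case: q => [|x0 q] uq i j; first by case: i.
by rewrite !(tnth_nth x0) => /eqP; rewrite nth_uniq// => /eqP /val_inj.
Qed.

Lemma size_filter_enum n (a : pred 'I_n) :
  size [seq i <- enum 'I_n | a i] = #|[set i | a i]|.
Proof.
rewrite -(card_uniqP (filter_uniq _ (enum_uniq _))).
by apply: eq_card => i; rewrite inE mem_filter fintype.mem_enum andbT.
Qed.

Section Average.
Variable R : realType.

Definition pattern_invariant (g : seq nat -> R) :=
  forall s : seq nat, uniq s -> g (pattern_of s) = g s.

Definition avg (g : seq nat -> R) n : R := (\sum_(s : 'S_n) g (word s)) / n`!%:R.

Lemma fact_neq0 n : n`!%:R != 0 :> R.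
Proof. by rewrite pnatr_eq0 -lt0n fact_gt0. Qed.

Lemma sum_word g n : \sum_(s : 'S_n) g (word s) = n`!%:R * avg g n.
Proof. by rewrite /avg mulrC divfK// fact_neq0. Qed.

Lemma card_Sn n : #|{: 'S_n}| = n`!.
Proof.
have -> : #|{: 'S_n}| = #|perm_on [set: 'I_n]|.
  by apply: eq_card => s; rewrite !inE; apply/esym/fintype.subsetP => x _; rewrite inE.
by rewrite card_perm cardsT card_ord.
Qed.

Variable g : seq nat -> R.
Hypothesis ginv : pattern_invariant g.

Lemma pattern_invariant_eq (T : eqType) (v w : T -> nat) (q : seq T) :
  uniq (map v q) -> uniq (map w q) ->
  {in q &, forall i j, (v i <= v j)%N = (w i <= w j)%N} ->
  g (map v q) = g (map w q).
Proof. by move=> uv uw vw; rewrite -ginv// (pattern_of_eq vw) ginv. Qed.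

(** Mapping [i] to the number of labels smaller than [v i] is a permutation that
    orders the indices as [v] does. *)
Lemma sum_injective n (v : 'I_n -> nat) : injective v ->
  \sum_(s : 'S_n) g [seq v (s i) | i <- enum 'I_n] = n`!%:R * avg g n.
Proof.
move=> vi.
have kP (i : 'I_n) : (#|[set j | (v j < v i)%N]| < n)%N.
  rewrite -[X in (_ < X)%N]card_ord -cardsT; apply: proper_card.
  by apply/fintype.properP; split; [exact/fintype.subsetP|exists i; rewrite !inE ?ltnn].
pose k i := Ordinal (kP i).
have kv i j : (v i <= v j)%N = (k i <= k j)%N.
  apply/idP/idP => [ij|].
    by apply: subset_leq_card; apply/fintype.subsetP => l; rewrite !inE => /leq_trans; apply.
  apply: contraTT; rewrite -!ltnNge => ji; apply: proper_card.
  apply/fintype.properP; split; last by exists j; rewrite !inE ?ltnn.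
  by apply/fintype.subsetP => l; rewrite !inE => lj; apply: ltn_trans ji.
have ki : injective k.
  move=> i j kij; apply: vi; apply/eqP.
  by rewrite eqn_leq !kv kij leqnn.
rewrite -sum_word [RHS](reindex_inj (mulIg (perm ki))); apply: eq_bigr => s _.
rewrite [RHS](_ : _ = g [seq val (k (s i)) | i <- enum 'I_n]); last first.
  by congr (g _); apply: eq_map => i; rewrite permM permE.
apply: pattern_invariant_eq => [||i j _ _]; rewrite ?kv// map_inj_uniq ?enum_uniq//.
  by move=> i j /vi /perm_inj.
by move=> i j /val_inj /ki /perm_inj.
Qed.

(** A rearrangement of the elements of [q] extends by the identity to a permutation
    supported on [B]. *)
Lemma perm_on_extend N (B : {set 'I_N}) (q : seq 'I_N) (r : 'S_(size q)) :
  uniq q -> {subset q <= B} ->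
  exists2 t : 'S_N, perm_on B t &
    [seq t x | x <- q] = [seq tnth (in_tuple q) (r i) | i <- enum 'I_(size q)].
Proof.
move=> uq qB.
pose q' := [seq tnth (in_tuple q) (r i) | i <- enum 'I_(size q)].
have sq' : size q' = size q by rewrite size_map size_enum_ord.
have uq' : uniq q'.
  by rewrite map_inj_uniq ?enum_uniq// => i j /(uniq_tnth_inj uq) /perm_inj.
have qq' : q' =i q.
  apply: (uniq_min_size uq' _ _).2; last by rewrite sq'.
  by move=> x /mapP[i _ ->]; rewrite mem_tnth.
pose f x := nth x q' (index x q).
have fq x : x \in q -> f x \in q by move=> xq; rewrite -qq' mem_nth// sq' index_mem.
have fNq x : x \notin q -> f x = x.
  by move=> xq; rewrite /f nth_default// sq' leqNgt index_mem.
have fi : injective f.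
  move=> x y; case: (boolP (x \in q)) => xq; case: (boolP (y \in q)) => yq.
  - rewrite /f (set_nth_default x y) ?sq' ?index_mem// => /eqP.
    rewrite nth_uniq ?sq' ?index_mem// => /eqP e.
    by rewrite -(nth_index x xq) e nth_index.
  - by move=> e; move: (fq _ xq); rewrite e fNq// (negbTE yq).
  - by move=> e; move: (fq _ yq); rewrite -e fNq// (negbTE xq).
  - by rewrite !fNq.
exists (perm fi).
  apply/fintype.subsetP => x; rewrite inE permE => fx; apply: qB.
  by apply: contraNT fx => /fNq ->.
rewrite -/q' -[RHS](@map_nth_index _ q q' uq sq'); apply: eq_map => x; exact: permE.
Qed.

(** By [perm_on_extend] the average over the permutations supported on [B] does not
    change when [q] is rearranged; averaging also over all rearrangements of [q] makes
    the pattern uniform, whatever the values taken on [q]. *)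
Lemma sum_perm_on N (B : {set 'I_N}) (v : 'I_N -> nat) (q : seq 'I_N) :
  injective v -> uniq q -> {subset q <= B} ->
  \sum_(t : 'S_N | perm_on B t) g [seq v (t x) | x <- q] =
  \sum_(t : 'S_N | perm_on B t) avg g (size q).
Proof.
move=> vi uq qB; set m := size q.
apply: (mulfI (fact_neq0 m)); rewrite -card_Sn mulr_natl -sumr_const.
rewrite (eq_bigr (fun r : 'S_m => \sum_(t : 'S_N | perm_on B t)
   g [seq v (t (tnth (in_tuple q) (r i))) | i <- enum 'I_m])); last first.
  move=> r _; have [t0 t0B t0q] := @perm_on_extend _ B _ r uq qB.
  rewrite (reindex_inj (mulgI t0)) /=; apply: eq_big => [t|t tB].
    apply/idP/idP => tB; last exact: perm_onM.
    by rewrite -[t](mulKg t0); apply: perm_onM => //; apply: perm_onV.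
  rewrite (map_comp (v \o t) (fun i => tnth (in_tuple q) (r i))) -t0q -map_comp.
  by congr (g _); apply: eq_map => x /=; rewrite permM.
rewrite exchange_big card_Sn mulr_sumr /=; apply: eq_bigr => t _.
apply: (@sum_injective m (fun i => v (t (tnth (in_tuple q) i)))) => i j /vi /perm_inj.
exact: uniq_tnth_inj.
Qed.

Definition boxcount N (P B : {set 'I_N}) (s : 'S_N) := #|[set i in P | s i \in B]|.

(** Given the number of points of the diagram of [s] in the box [P * B], their pattern
    is uniform: composing [s] with the permutations supported on [B] changes neither
    the positions in [P] whose values lie in [B] nor the law of [s]. The values are
    read through arbitrary labels [v] because ties have to be broken later on. *)
Lemma sum_restrict_box N (P B : {set 'I_N}) (v : 'I_N -> nat) : injective v ->
  \sum_(s : 'S_N) g [seq v (s i) | i <- enum 'I_N & (i \in P) && (s i \in B)] =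
  \sum_(s : 'S_N) avg g (boxcount P B s).
Proof.
move=> vi; set G := #|[pred t : 'S_N | perm_on B t]|.
have G0 : G%:R != 0 :> R.
  by rewrite pnatr_eq0 -lt0n; apply/card_gt0P; exists 1%g; rewrite inE perm_on1.
apply: (mulfI G0); rewrite !mulr_sumr [RHS](eq_bigr (fun s : 'S_N =>
  \sum_(t : 'S_N | perm_on B t) g [seq v (t x) | x <-
    [seq s i | i <- enum 'I_N & (i \in P) && (s i \in B)]])); last first.
  move=> s _; rewrite sum_perm_on//.
  - rewrite sumr_const mulr_natl; congr (avg _ _ *+ _).
    by rewrite size_map size_filter_enum.
  - by rewrite map_inj_uniq; [exact/filter_uniq/enum_uniq|exact: perm_inj].
  - by move=> x /mapP[i]; rewrite mem_filter => /andP[/andP[_ ?] _] ->.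
rewrite exchange_big /= -mulr_sumr mulr_natl -sumr_const; apply: eq_bigr => t tB.
rewrite (reindex_inj (mulIg t)); apply: eq_bigr => s _.
congr (g _); rewrite -map_comp (@eq_filter _ _ (fun i => (i \in P) && (s i \in B))).
  by apply: eq_map => i /=; rewrite permM.
by move=> i; rewrite permM (perm_closed _ tB).
Qed.
End Average.

(** * Superadditivity along diagonal boxes *)

Section Moments.
Variables (R : realType) (N : nat).
Implicit Types P B : {set 'I_N}.

Lemma sum_pair_eq (F : 'I_N -> 'I_N -> R) i j i' j' : i != j -> i' != j' ->
  \sum_(s : 'S_N) F (s i) (s j) = \sum_(s : 'S_N) F (s i') (s j').
Proof.
move=> ij i'j'.
have [t ti tj] : exists2 t : 'S_N, t i = i' & t j = j'.
  exists (tperm i i' * tperm (tperm i i' j) j')%g; last by rewrite permM tpermL.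
  rewrite permM tpermL tpermD// 1?eq_sym//.
  by rewrite -[i' in i' != _](tpermL i i') (inj_eq perm_inj).
rewrite (reindex_inj (mulgI t)); apply: eq_bigr => s _.
by rewrite !permM ti tj.
Qed.

Let X B (s : 'S_N) i : R := (s i \in B)%:R.

Lemma sum_column B (s : 'S_N) : \sum_i X B s i = #|B|%:R.
Proof.
rewrite -sum1_card natr_sum [RHS](reindex_inj (@perm_inj _ s)) [RHS]big_mkcond /=.
by apply: eq_bigr => i _; rewrite /X; case: ifP.
Qed.

Lemma boxcountE P B (s : 'S_N) : (boxcount P B s)%:R = \sum_(i in P) X B s i.
Proof.
rewrite /boxcount -sum1_card natr_sum big_mkcond [RHS]big_mkcond /=.
by apply: eq_bigr => i _; rewrite !inE /X; case: (i \in P); case: (s i \in B).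
Qed.

Lemma sum_point B i : N%:R * \sum_(s : 'S_N) X B s i = N`!%:R * #|B|%:R :> R.
Proof.
rewrite -card_Sn [RHS]mulr_natl -sumr_const.
rewrite -(eq_bigr _ (fun s _ => sum_column B s)) exchange_big /=.
rewrite -[X in X%:R * _]card_ord mulr_natl -sumr_const; apply: eq_bigr => j _.
rewrite (reindex_inj (mulgI (tperm j i))) /=; apply: eq_bigr => s _.
by rewrite /X permM tpermR.
Qed.

(** The events that [s i] and [s j] lie in [B] are negatively correlated: by symmetry
    the sum is the same for all pairs of distinct positions, and the average over
    these pairs is explicit. *)
Lemma sum_pair_le B i j : i != j ->
  N%:R ^+ 2 * \sum_(s : 'S_N) X B s i * X B s j <= N`!%:R * #|B|%:R ^+ 2 :> R.
Proof.
move=> ij; set S := \sum_s _; set b := #|B|%:R : R.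
have N2 : (1 < N)%N.
  by move: ij (ltn_ord i) (ltn_ord j); rewrite -val_eqE /=; lia.
have bN : b <= N%:R by rewrite ler_nat -[N in (_ <= N)%N]card_ord max_card.
have e : N%:R * (N%:R - 1) * S = N`!%:R * (b ^+ 2 - b).
  have -> : N`!%:R * (b ^+ 2 - b) = \sum_(s : 'S_N) \sum_i0 \sum_(j0 | j0 != i0) X B s i0 * X B s j0.
    rewrite -card_Sn mulr_natl -sumr_const; apply: eq_bigr => s _.
    have bE : b = \sum_i0 X B s i0 by rewrite sum_column.
    rewrite expr2 {1}bE mulr_suml {2}bE -sumrB.
    apply: eq_bigr => i0 _; rewrite bE (bigD1 i0)//= mulrDr mulr_sumr.
    have -> : X B s i0 * X B s i0 = X B s i0.
      by rewrite /X; case: (s i0 \in B); rewrite ?mulr1 ?mulr0.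
    by rewrite addrC addKr.
  rewrite exchange_big /= (eq_bigr (fun i0 : 'I_N => (N%:R - 1) * S)); last first.
    move=> i0 _; rewrite exchange_big /= (eq_bigr (fun=> S)); last first.
      by move=> j0 ji; apply: (@sum_pair_eq (fun x y => (x \in B)%:R * (y \in B)%:R)) => //; rewrite eq_sym.
    rewrite sumr_const (_ : #|_| = N.-1); last by rewrite -[in RHS](card_ord N) -(cardC1 i0); apply: eq_card.
    by rewrite -[LHS]mulr_natl -subn1 natrB ?(ltnW N2).
  by rewrite sumr_const card_ord -[RHS]mulr_natl mulrA.
have N0 : 0 < N%:R - 1 :> R by rewrite subr_gt0 ltr1n.
rewrite -(ler_pM2l N0).
have -> : (N%:R - 1) * (N%:R ^+ 2 * S) = N%:R * (N%:R * (N%:R - 1) * S) by ring.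
rewrite e -subr_ge0.
have -> : (N%:R - 1) * (N`!%:R * b ^+ 2) - N%:R * (N`!%:R * (b ^+ 2 - b)) =
  N`!%:R * (b * (N%:R - b)) by ring.
by rewrite !mulr_ge0// ?subr_ge0// ler0n.
Qed.

(** By negative correlation the variance of the number of points in a box is at most
    its mean [mu]. *)
Lemma boxcount_variance P B (mu := #|P|%:R * #|B|%:R / N%:R : R) : (0 < N)%N ->
  \sum_(s : 'S_N) ((boxcount P B s)%:R - mu) ^+ 2 <= N`!%:R * mu.
Proof.
move=> N0; have n0 : N%:R != 0 :> R by rewrite pnatr_eq0 -lt0n.
have np : 0 < N%:R ^+ 2 :> R by rewrite exprn_gt0// ltr0n.
pose p := #|P|%:R : R; pose b := #|B|%:R : R.
have mean : N%:R * \sum_(s : 'S_N) (boxcount P B s)%:R = N`!%:R * b * p :> R.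
  rewrite (eq_bigr _ (fun s _ => boxcountE P B s)) exchange_big /= mulr_sumr.
  by rewrite (eq_bigr _ (fun i _ => sum_point B i)) sumr_const -[LHS]mulr_natr.
have sq : N%:R ^+ 2 * \sum_(s : 'S_N) (boxcount P B s)%:R ^+ 2 <=
    N`!%:R * (p * b * N%:R + p ^+ 2 * b ^+ 2) :> R.
  have -> : \sum_(s : 'S_N) (boxcount P B s)%:R ^+ 2 =
      \sum_(i in P) (\sum_(s : 'S_N) X B s i
        + \sum_(j in P | j != i) \sum_(s : 'S_N) X B s i * X B s j) :> R.
    rewrite (eq_bigr (fun s => \sum_(i in P) (X B s i + \sum_(j in P | j != i) X B s i * X B s j))).
      rewrite exchange_big /=; apply: eq_bigr => i iP; rewrite big_split /=; congr (_ + _).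
      by rewrite exchange_big.
    move=> s _; rewrite boxcountE expr2 mulr_suml; apply: eq_bigr => i iP.
    rewrite (bigD1 i)//= mulrDr mulr_sumr; congr (_ + _).
    by rewrite /X; case: (_ \in _); rewrite ?mulr1 ?mulr0.
  rewrite mulr_sumr.
  have -> : N`!%:R * (p * b * N%:R + p ^+ 2 * b ^+ 2) =
      \sum_(i in P) (N`!%:R * b * N%:R + N`!%:R * b ^+ 2 * p).
    by rewrite sumr_const -[RHS]mulr_natr -/p; ring.
  apply: ler_sum => i iP; rewrite mulrDr lerD//.
    by rewrite expr2 -mulrA sum_point mulrC.
  have -> : N`!%:R * b ^+ 2 * p = \sum_(j in P) (N`!%:R * b ^+ 2).
    by rewrite sumr_const -[RHS]mulr_natr.
  rewrite mulr_sumr [leRHS](bigID (fun j => j != i)) /= -[leLHS]addr0 lerD//.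
    by apply: ler_sum => j /andP[_ ji]; apply: sum_pair_le; rewrite eq_sym.
  by apply: sumr_ge0 => j _; rewrite mulr_ge0// ?ler0n// exprn_ge0// ler0n.
rewrite -(ler_pM2l np).
have -> : \sum_(s : 'S_N) ((boxcount P B s)%:R - mu) ^+ 2 =
  \sum_(s : 'S_N) (boxcount P B s)%:R ^+ 2 - 2 * mu * \sum_(s : 'S_N) (boxcount P B s)%:R + N`!%:R * mu ^+ 2.
  rewrite -card_Sn [X in _ + X]mulr_natl -sumr_const mulr_sumr -sumrB -big_split /=.
  by apply: eq_bigr => s _; ring.
have muE : mu * N%:R = p * b by rewrite /mu divfK.
rewrite mulrDr mulrBr.
have -> : N%:R ^+ 2 * (2 * mu * \sum_(s : 'S_N) (boxcount P B s)%:R) = 2 * N`!%:R * (mu * N%:R) ^+ 2.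
  have -> : N%:R ^+ 2 * (2 * mu * \sum_(s : 'S_N) (boxcount P B s)%:R) =
    2 * (mu * N%:R) * (N%:R * \sum_(s : 'S_N) (boxcount P B s)%:R) by ring.
  by rewrite mean muE; ring.
have -> : N%:R ^+ 2 * (N`!%:R * mu ^+ 2) = N`!%:R * (mu * N%:R) ^+ 2 by ring.
have -> : N%:R ^+ 2 * (N`!%:R * mu) = N`!%:R * (mu * N%:R) * N%:R by ring.
rewrite muE; apply: le_trans (_ : N`!%:R * (p * b * N%:R + p ^+ 2 * b ^+ 2) -
  2 * N`!%:R * (p * b) ^+ 2 + N`!%:R * (p * b) ^+ 2 <= _); first by rewrite !lerD2r.
by rewrite le_eqVlt; apply/orP; left; apply/eqP; ring.
Qed.
End Moments.
Section Super.
Variables (R : realType) (A : set (seq nat)).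
Hypotheses (A0 : A [::]) (sumA : sum_closed A).

Definition lenA (s : seq nat) : R := (longest A s)%:R.

Lemma lenA_invariant : pattern_invariant lenA.
Proof. by move=> s _; rewrite /lenA longest_pattern_of. Qed.

Definition expect n : R := avg lenA n.

Lemma expect_ge0 n : 0 <= expect n.
Proof. by rewrite divr_ge0 ?ler0n// sumr_ge0// => s _; rewrite ler0n. Qed.

Lemma card_ltn_ord m n : (m <= n)%N -> #|[set i : 'I_n | (i < m)%N]| = m.
Proof.
have wi (mn : (m <= n)%N) : injective (widen_ord mn) by move=> i j [] /val_inj.
move=> mn; rewrite -[RHS](card_ord m) -(card_imset predT (wi mn)).
apply: eq_card => i; rewrite inE; apply/idP/imsetP => [im|[j _ ->]]; last by rewrite /= ltn_ord.
by exists (Ordinal im) => //; apply: val_inj.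
Qed.

Lemma expect_mono m n : (m <= n)%N -> expect m <= expect n.
Proof.
move=> mn; rewrite -(ler_pM2l (_ : 0 < n`!%:R)) ?ltr0n ?fact_gt0// -sum_word.
have := sum_restrict_box lenA_invariant [set i : 'I_n | (i < m)%N] [set: 'I_n] (v := val) val_inj.
rewrite [X in _ = X -> _](eq_bigr (fun=> expect m)) => [|s _]; last first.
  suff -> : boxcount [set i : 'I_n | (i < m)%N] [set: 'I_n] s = m by [].
  rewrite -[RHS](card_ltn_ord mn) /boxcount; congr #|pred_of_set _|.
  by apply/setP => i; rewrite !inE andbT.
rewrite sumr_const card_Sn -[_ *+ _]mulr_natl => <-; apply: ler_sum => s _.
by rewrite ler_nat; apply: longest_subseq => //; apply/map_subseq/filter_subseq.
Qed.

Lemma sorted_enum_ord n : sorted (fun i j : 'I_n => (i < j)%N) (enum 'I_n).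
Proof. by have := iota_ltn_sorted 0 n; rewrite -val_enum_ord sorted_map. Qed.

Lemma subseq_enum_ord n (t : seq 'I_n) (a : pred 'I_n) :
  sorted (fun i j : 'I_n => (i < j)%N) t -> all a t -> subseq t [seq i <- enum 'I_n | a i].
Proof.
move=> st at_; have tr : transitive (fun i j : 'I_n => (i < j)%N) by move=> y x z; apply: ltn_trans.
have -> : t = [seq i <- [seq i <- enum 'I_n | a i] | i \in t]; last exact: filter_subseq.
rewrite -filter_predI; apply: (irr_sorted_eq tr) => // [i|| i]; first exact: ltnn.
  exact: sorted_filter (sorted_enum_ord _).
by rewrite mem_filter fintype.mem_enum andbT /= andb_idr// => /(allP at_).
Qed.

Definition block k b (j : nat) : {set 'I_(k * b)} := [set i : 'I_(k * b) | i %/ b == j]%N.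

Lemma card_block k b j : (j < k)%N -> #|block k b j| = b.
Proof.
move=> jk; have hP (i : 'I_b) : (j * b + i < k * b)%N.
  by apply: leq_trans (_ : j.+1 * b <= _)%N; rewrite ?leq_mul2r ?jk ?orbT// mulSn addnC ltn_add2r.
pose h i := Ordinal (hP i).
have hi : injective h by move=> x y [] /addnI /val_inj.
rewrite -[RHS](card_ord b) -(card_imset predT hi).
apply: eq_card => i; rewrite inE; apply/eqP/imsetP => [ij|[x _ ->]] /=; last first.
  by rewrite divnMDl ?divn_small ?addn0//; case: (b) x => [[]|].
have b0 : (0 < b)%N by case: (b) i {h hi hP ij} => // -[m]; rewrite muln0.
exists (Ordinal (ltn_pmod i b0)) => //; apply: val_inj => /=.
by rewrite -ij -divn_eq.
Qed.

Lemma longest_blocks k b (s : 'S_(k * b)) :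
  (\sum_(j < k) longest A [seq val (s i) | i <- enum 'I_(k * b) &
      (i \in block k b j) && (s i \in block k b j)] <= longest A (word s))%N.
Proof.
pose F J := [seq i : 'I_(k * b) <- enum 'I_(k * b) | (i %/ b == s i %/ b)%N && (i %/ b < J)%N].
have key J : (\sum_(j < J) longest A [seq val (s i) | i <- enum 'I_(k * b) &
      (i \in block k b j) && (s i \in block k b j)] <= longest A [seq val (s i) | i <- F J])%N.
  elim: J => [|J IH]; first by rewrite big_ord0.
  rewrite big_ord_recr /=; apply: leq_trans (leq_add IH (leqnn _)) _.
  set G := [seq _ <- _ | _].
  have -> : F J.+1 = F J ++ G.
    apply: (@irr_sorted_eq _ (fun i j : 'I_(k * b) => (i < j)%N)).
    - by move=> y x z; apply: ltn_trans.
    - by move=> x; rewrite /= ltnn.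
    - by apply: sorted_filter (sorted_enum_ord _) => y x z; apply: ltn_trans.
    - have tr : transitive (fun i j : 'I_(k * b) => (i < j)%N).
        by move=> y x z; apply: ltn_trans.
      have sf a : sorted (fun i j : 'I_(k * b) => (i < j)%N) (seq.filter a (enum 'I_(k * b))).
        exact: sorted_filter (sorted_enum_ord _).
      rewrite sorted_pairwise// pairwise_cat -!sorted_pairwise// !sf !andbT.
      apply/allrelP => x y; rewrite !mem_filter !inE => /andP[/andP[_ xJ] _] /andP[/andP[/eqP yJ _] _].
      by rewrite -yJ in xJ; apply: contraTT xJ; rewrite -!leqNgt; exact: leq_div2r.
    - have mf a x : (x \in seq.filter a (enum 'I_(k * b))) = a x.
        by rewrite mem_filter fintype.mem_enum andbT.
      move=> x; rewrite mem_cat !mf !inE ltnS leq_eqVlt andb_orr orbC.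
congr (_ || _); apply/andP/andP => -[/eqP e1 /eqP e2]; first by rewrite -e1 e2.
      by rewrite e1 e2.
  rewrite map_cat; apply: longest_cat => // x y /mapP[i + ->] /mapP[j + ->].
  rewrite !mem_filter !inE => /andP[/andP[/eqP e iJ] _] /andP[/andP[_ /eqP jJ] _].
  rewrite e -jJ in iJ; apply: contraTT iJ; rewrite -!leqNgt; exact: leq_div2r.
apply: leq_trans (key k) _; apply: longest_subseq => //.
exact/map_subseq/filter_subseq.
Qed.

(** The optimal subsequences of the [k] diagonal boxes can be concatenated. A box
    contains [n] points on average, and by Chebyshev's inequality it contains at
    least [m < n] of them with the probability that appears as a factor. *)
Lemma expect_super k m n : (m < n)%N ->
  k%:R * (expect m * (1 - n%:R / (n%:R - m%:R) ^+ 2)) <= expect (k * (k * n)).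
Proof.
move=> mn; have [->|k0] := posnP k; first by rewrite mul0r expect_ge0.
pose b := (k * n)%N; pose N := (k * b)%N.
have N0 : (0 < N)%N by rewrite !muln_gt0 k0 (leq_trans _ mn).
have fN : 0 < N`!%:R :> R by rewrite ltr0n fact_gt0.
have nm : 0 < n%:R - m%:R :> R by rewrite subr_gt0 ltr_nat.
rewrite -(ler_pM2l fN) -/N -sum_word.
apply: le_trans (_ : \sum_(s : 'S_N) \sum_(j < k) lenA [seq val (s i) | i <- enum 'I_(k * b) &
      (i \in block k b j) && (s i \in block k b j)] <= _); last first.
  by apply: ler_sum => s _; rewrite -natr_sum ler_nat; exact: longest_blocks.
rewrite exchange_big /= mulrCA; set x := _ * (expect m * _).
have -> : k%:R * x = \sum_(j < k) x by rewrite sumr_const card_ord mulr_natl.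
apply: ler_sum => j _; rewrite (sum_restrict_box lenA_invariant)//; last exact: val_inj.
pose M (s : 'S_N) : R := (boxcount (block k b j) (block k b j) s)%:R.
apply: le_trans (_ : \sum_(s : 'S_N) expect m * (1 - (M s - n%:R) ^+ 2 / (n%:R - m%:R) ^+ 2) <= _).
  rewrite -mulr_sumr /x mulrCA ler_wpM2l ?expect_ge0// sumrB sumr_const card_Sn mulrBr mulr1 lerB//.
  rewrite -mulr_suml mulrA ler_wpM2r ?invr_ge0 ?sqr_ge0//.
  have := boxcount_variance R (block k b j) (block k b j) N0.
  rewrite !card_block//.
  have -> // : b%:R * b%:R / N%:R = n%:R :> R.
  rewrite /N /b !natrM; field; rewrite !pnatr_eq0 -!lt0n k0; lia.
apply: ler_sum => s _; have [mM|Mm] := leqP m (boxcount (block k b j) (block k b j) s).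
  apply: le_trans (expect_mono mM); rewrite -[leRHS]mulr1 ler_wpM2l ?expect_ge0//.
  by rewrite gerBl divr_ge0 ?sqr_ge0.
apply: le_trans (expect_ge0 _); rewrite mulr_ge0_le0 ?expect_ge0// subr_le0.
rewrite ler_pdivlMr ?exprn_gt0// mul1r -[leRHS]sqrrN opprB.
have : M s < m%:R by rewrite /M ltr_nat.
move=> ?; rewrite lerXn2r ?nnegrE; lra.
Qed.

End Super.

(** * Matrices avoiding a permutation *)

Local Open Scope nat_scope.

Section MarcusTardos.
Variable W : nat.
Implicit Types (M : {set 'I_W * 'I_W}) (e : 'I_W * 'I_W).

Definition contains k (s : 'S_k) M := exists r c : 'I_k -> 'I_W,
  [/\ {homo r : i j / i < j}, {homo c : i j / i < j} & forall i, (r i, c (s i)) \in M].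

Lemma increasing_pick k (X : {set 'I_W}) : k <= #|X| ->
  exists2 r : 'I_k -> 'I_W, {homo r : i j / i < j} & forall i, r i \in X.
Proof.
move=> kX; have h (i : 'I_k) : i < size (enum X) by rewrite -cardE (leq_trans _ kX).
have sX : sorted (fun i j : 'I_W => i < j) (enum X).
  by rewrite /enum_mem -enumT; apply: sorted_filter (sorted_enum_ord _) => y x z; apply: ltn_trans.
exists (fun i => tnth (in_tuple (enum X)) (Ordinal (h i))) => [i j ij|i]; last first.
  by rewrite -fintype.mem_enum mem_tnth.
set x0 := tnth _ (Ordinal (h i)); rewrite (tnth_nth x0) /x0 (tnth_nth x0) /=.
have tr : transitive (fun i j : 'I_W => i < j) by move=> y x z; apply: ltn_trans.
rewrite (set_nth_default x0 (nth x0 _ _))//.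
exact: (@sorted_ltn_nth _ _ tr x0 _ sX i j (h i) (h j) ij).
Qed.

Variable q : nat.
Hypothesis q0 : 0 < q.

(** All matrices are subsets of the square of a fixed ['I_W]; coarsening divides the
    indices by [q] and stays in the same type, so that no matrix size needs a cast. *)
Definition shrink (x : 'I_W) : 'I_W := Ordinal (leq_ltn_trans (leq_div x q) (ltn_ord x)).

Lemma shrink_lt (x y : 'I_W) : shrink x < shrink y -> x < y.
Proof. by apply: contraTT; rewrite -!leqNgt; apply: leq_div2r. Qed.

Lemma card_shrink (J : 'I_W) : #|[set x | shrink x == J]| <= q.
Proof.
pose h (x : 'I_W) := Ordinal (ltn_pmod x q0).
rewrite -[X in _ <= X](card_ord q) -(@card_in_imset _ _ h) ?max_card// => x y.
rewrite !inE -!val_eqE /= => /eqP xJ /eqP yJ [] xy; apply: val_inj => /=.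
by rewrite (divn_eq x q) (divn_eq y q) xJ yJ xy.
Qed.

Definition cell e := (shrink e.1, shrink e.2).

Lemma card_cell e0 : #|[set e | cell e == e0]| <= q ^ 2.
Proof.
rewrite (_ : [set e | _] = finset.setX [set x | shrink x == e0.1] [set x | shrink x == e0.2]).
  by rewrite cardsX expnS expn1 leq_mul ?card_shrink.
by apply/setP => -[x y]; rewrite !inE /cell /= -pair_eqE.
Qed.

(** Strictly increasing block indices force strictly increasing indices, whichever
    entry is chosen in each block. *)
Lemma contains_cells k (s : 'S_k) M : contains s (cell @: M) -> contains s M.
Proof.
case=> r [c [rm cm H]].
have /choice[e He] i : exists e, e \in M /\ cell e = (r i, c (s i)).
  by have /imsetP[e eM ->] := H i; exists e.
have e1 i : shrink (e i).1 = r i by case: (He i) => _ [].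
have e2 i : shrink (e i).2 = c (s i) by case: (He i) => _ [].
exists (fun i => (e i).1), (fun j => (e (s^-1%g j)).2); split.
- by move=> i j ij; apply: shrink_lt; rewrite !e1; apply: rm.
- by move=> i j ij; apply: shrink_lt; rewrite !e2 !permKV; apply: cm.
- by move=> i; rewrite permK -surjective_pairing; case: (He i).
Qed.

Definition cols M e0 := [set e.2 | e in M & cell e == e0].
Definition rows M e0 := [set e.1 | e in M & cell e == e0].

Definition wide k M (J : 'I_W) :=
  [set e in cell @: M | (e.2 == J) && (k <= #|cols M e|)].
Definition tall k M (I : 'I_W) :=
  [set e in cell @: M | (e.1 == I) && (k <= #|rows M e|)].

(** Pigeonhole: each wide block of the block column [J] has entries in some [k]
    columns, and [k] such blocks with the same [k] columns would together contain
    every permutation of size [k]. *)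
Lemma card_wide k (s : 'S_k) M J : ~ contains s M -> #|wide k M J| <= k * 2 ^ q.
Proof.
move=> nM.
have /choice[K HK] e : exists K : {set 'I_W}, e \in wide k M J -> K \subset cols M e /\ #|K| = k.
  case: (boolP (e \in wide k M J)) => [|_]; last by exists finset.set0.
  rewrite inE => /andP[_ /andP[_ /card_geqP[t [ut st tK]]]].
  exists [set x in t] => _; split; first by apply/fintype.subsetP => x; rewrite inE; apply: tK.
  by rewrite -st -(card_uniqP ut); apply: eq_card => x; rewrite inE.
pose CJ := [set x | shrink x == J].
have KC e : e \in wide k M J -> K e \in powerset CJ.
  move=> ew; rewrite inE; apply: fintype.subset_trans (HK e ew).1 _.
  move: ew; rewrite inE => /andP[_ /andP[/eqP eJ _]].
  by apply/fintype.subsetP => _ /imsetP[f + ->]; rewrite !inE -eJ => /andP[_ /eqP <-].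
rewrite -sum1_card (partition_big K (fun X => X \in powerset CJ) KC) /=.
apply: leq_trans (_ : \sum_(X in powerset CJ) k <= _); last first.
  by rewrite sum_nat_const card_powerset mulnC leq_mul2l leq_exp2l ?card_shrink ?orbT.
apply: leq_sum => X _; rewrite sum1_card; apply: contra_notT nM; rewrite -ltnNge => kX.
pose F := [set e in wide k M J | K e == X].
have F2 e : e \in F -> e.2 = J by rewrite !inE => /andP[/andP[_ /andP[/eqP]]].
have [r rm rF] : exists2 r : 'I_k -> 'I_W, {homo r : i j / i < j} & forall i, r i \in fst @: F.
  apply: increasing_pick; rewrite card_in_imset.
    apply: leq_trans (ltnW kX) _; apply: subset_leq_card; apply/fintype.subsetP => e eX.
    by rewrite inE; exact: eX.
  by move=> [a b] [a' b'] /F2 /= -> /F2 /= -> ->.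
have rF' i : (r i, J) \in F.
  by have /imsetP[[a b] eF ->] := rF i; rewrite /= -(F2 _ eF).
have [c cm cX] : exists2 c : 'I_k -> 'I_W, {homo c : i j / i < j} & forall i, c i \in X.
  apply: increasing_pick; case: (posnP k) => [->//|k0].
  have := rF' (Ordinal k0); rewrite inE => /andP[/HK[_ cK] /eqP KX].
  by rewrite -KX cK.
have /choice[e He] i : exists e, [/\ e \in M, cell e = (r i, J) & e.2 = c (s i)].
  have := rF' i; rewrite inE => /andP[/HK[/fintype.subsetP sub _] /eqP KX].
  have /imsetP[f + ->] : c (s i) \in cols M (r i, J) by apply: sub; rewrite KX.
  by rewrite inE => /andP[fM /eqP fr]; exists f.
exists (fun i => (e i).1), c; split => //.
  move=> i j ij; apply: shrink_lt; have [_ [-> _] _] := He i; have [_ [-> _] _] := He j.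
  exact: rm.
by move=> i; have [eM _ <-] := He i; rewrite -surjective_pairing.
Qed.

Definition swap e := (e.2, e.1).

Lemma swapK : involutive swap. Proof. by case. Qed.

(** Transposition exchanges wide and tall blocks, and [s] with its inverse. *)
Lemma card_tall k (s : 'S_k) M I : ~ contains s M -> #|tall k M I| <= k * 2 ^ q.
Proof.
move=> nM.
have nT : ~ contains (s^-1)%g (swap @: M).
  move=> [r [c [rm cm H]]]; apply: nM; exists c, r; split=> // i.
  have /imsetP[[a b] eM [er ec]] := H (s i).
  by move: ec er eM; rewrite permK => <- <-.
have := card_wide I nT; apply: leq_trans.
rewrite -(card_imset _ (inv_inj swapK)); apply: subset_leq_card.
apply/fintype.subsetP => _ /imsetP[e + ->]; rewrite !inE /= => /andP[/imsetP[f fM ef] /andP[-> ke]].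
apply/andP; split; first by apply/imsetP; exists (swap f); rewrite ?imset_f// ef.
apply: leq_trans ke _; apply: subset_leq_card; apply/fintype.subsetP => x /imsetP[g + ->].
rewrite inE => /andP[gM /eqP ge]; apply/imsetP; exists (swap g) => //.
by rewrite inE imset_f//= -ge.
Qed.

Definition box n : {set 'I_W * 'I_W} := [set e : 'I_W * 'I_W | (e.1 < n) && (e.2 < n)].

Lemma cells_box n M : M \subset box (q * n) -> cell @: M \subset box n.
Proof.
move=> /fintype.subsetP Mb; apply/fintype.subsetP => _ /imsetP[e /Mb + ->].
by rewrite !inE /= !ltn_divLR// ![n * q]mulnC.
Qed.

Lemma card_col_sum n (w : 'I_W -> {set 'I_W * 'I_W}) (p : 'I_W * 'I_W -> 'I_W) (X : {set 'I_W * 'I_W}) c :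
  (forall J, w J = [set e in X | p e == J]) -> (forall J, #|w J| <= c) ->
  (forall e, e \in X -> p e < n) -> #|X| <= n * c.
Proof.
move=> wE wc pX; rewrite -sum1_card (partition_big p (fun J : 'I_W => J < n)) //=.
apply: leq_trans (_ : \sum_(J < W | J < n) c <= _).
  apply: leq_sum => J _; apply: leq_trans (wc J).
  by rewrite wE -sum1_card; apply: eq_leq; apply: eq_bigl => e; rewrite inE.
rewrite sum_nat_const leq_mul2r; apply/orP; right.
have [nW|Wn] := leqP n W; last by apply: leq_trans (max_card _) _; rewrite card_ord ltnW.
by rewrite -[X in _ <= X](@card_ltn_ord n W nW); apply: eq_leq; apply: eq_card => i; rewrite !inE.
Qed.

(** The heart of the Marcus-Tardos argument: few blocks are wide or tall, and
    a block that is neither has entries in fewer than [k] rows and [k] columns. *)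
Lemma blocks_bound k (s : 'S_k) M n : ~ contains s M -> M \subset box (q * n) ->
  #|M| <= k.-1 ^ 2 * #|cell @: M| + n * (2 * (k * 2 ^ q) * q ^ 2).
Proof.
move=> nM Mb; set B := cell @: M.
pose w := [set e in B | k <= #|cols M e|]; pose t := [set e in B | k <= #|rows M e|].
have Bn := fintype.subsetP (cells_box Mb).
have cw : #|w| <= n * (k * 2 ^ q).
  apply: (@card_col_sum n (wide k M) snd) => [J|J|e].
  - by apply/setP => e; rewrite !inE -andbA; congr (_ && _); rewrite andbC.
  - exact: card_wide nM.
  - by rewrite inE => /andP[/Bn]; rewrite inE => /andP[].
have ct : #|t| <= n * (k * 2 ^ q).
  apply: (@card_col_sum n (tall k M) fst) => [J|J|e].
  - by apply/setP => e; rewrite !inE -andbA; congr (_ && _); rewrite andbC.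
  - exact: card_tall nM.
  - by rewrite inE => /andP[/Bn]; rewrite inE => /andP[].
pose S e0 := [set e in M | cell e == e0].
have -> : #|M| = \sum_(e0 in B) #|S e0|.
  rewrite -sum1_card (partition_big cell (fun e0 => e0 \in B)) /=; last exact: imset_f.
  by apply: eq_bigr => e0 _; rewrite -sum1_card; apply: eq_bigl => e; rewrite inE.
have Sq e0 : #|S e0| <= q ^ 2.
  apply: leq_trans (card_cell e0); apply: subset_leq_card.
  by apply/fintype.subsetP => e; rewrite !inE => /andP[].
apply: leq_trans (_ : \sum_(e0 in B) (k.-1 ^ 2 + ((e0 \in w) * q ^ 2 + (e0 \in t) * q ^ 2)) <= _).
  apply: leq_sum => e0 eB; rewrite !inE eB /=.
  have [//=|rk] := leqP k #|rows M e0|.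
    by move=> _; apply: leq_trans (Sq e0) _; rewrite mul1n; lia.
  have [//=|ck] := leqP k #|cols M e0|.
    by move=> _; apply: leq_trans (Sq e0) _; rewrite mul1n; lia.
  rewrite !mul0n !addn0; apply: leq_trans (_ : #|finset.setX (rows M e0) (cols M e0)| <= _).
    apply: subset_leq_card; apply/fintype.subsetP => e eS; rewrite inE.
    by apply/andP; split; apply/imsetP; exists e.
  by rewrite cardsX expnS expn1 leq_mul//; lia.
rewrite !big_split /= -!big_distrl /= sum_nat_const.
rewrite [X in X + _](_ : _ = k.-1 ^ 2 * #|B|) ?leq_add2l; last by rewrite -mulnA mulnC mulnn.
have sc (X : {set 'I_W * 'I_W}) : X \subset B -> \sum_(e0 in B) (e0 \in X : nat) = #|X|.
  move=> XB; rewrite -sum1_card [RHS](big_setID B) /= [X in _ + X]big1 ?addn0.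
    rewrite big_mkcond [RHS]big_mkcond; apply: eq_bigr => e _; rewrite inE.
    by case: (e \in B); case: (e \in X).
  by move=> e; rewrite inE => /andP[/negP nB /(fintype.subsetP XB)].
rewrite !sc; last 2 first.
- by apply/fintype.subsetP => e; rewrite inE => /andP[].
- by apply/fintype.subsetP => e; rewrite inE => /andP[].
rewrite -mulnDl mulnA leq_mul2r; apply/orP; right.
by apply: leq_trans (leq_add cw ct) _; rewrite mul2n -addnn mulnDr.
Qed.

(** The coarsened matrix avoids [s] too, and [k.-1 ^ 2 < q] makes the recursive
    bound of [blocks_bound] linear in the size [q ^ l]. *)
Lemma marcus_tardos k (s : 'S_k) l M : k.-1 ^ 2 < q ->
  ~ contains s M -> M \subset box (q ^ l) ->
  #|M| <= (2 * (k * 2 ^ q) * q ^ 2).+1 * q ^ l.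
Proof.
set D := 2 * _ * _ => kq; elim: l M => [|l IH] M nM Mb.
  rewrite expn0 muln1; apply: (@leq_trans 1) => //; apply/card_le1P => -[a b] eM [a' b'].
  have := fintype.subsetP Mb _ eM; rewrite inE expn0 /= !ltnS !leqn0 => /andP[/eqP a0 /eqP b0].
  apply/idP/eqP => [fM|[-> ->]//]; have := fintype.subsetP Mb _ fM.
  by rewrite inE expn0 /= !ltnS !leqn0 => /andP[/eqP a0' /eqP b0']; congr pair; apply: val_inj; rewrite /= ?a0 ?b0.
rewrite expnS in Mb *.
have := IH (cell @: M) (fun c => nM (contains_cells c)) (cells_box Mb).
have := blocks_bound nM Mb; rewrite -/D.
move: #|M| #|cell @: M| (q ^ l) => a b Q; nia.
Qed.

Definition avoiders k (s : 'S_k) n :=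
  [set M : {set 'I_W * 'I_W} | (M \subset box n) && `[< ~ contains s M >]].

(** Klazar's reduction: an avoiding matrix is determined by its coarsening, which is
    avoiding and hence has linearly many blocks, and by the contents of these
    blocks; this leaves at most [2 ^ (q ^ 2)] choices per block. *)
Lemma card_avoiders k (s : 'S_k) l (C := (2 * (k * 2 ^ q) * q ^ 2).+1) :
  k.-1 ^ 2 < q -> 1 < q -> #|avoiders s (q ^ l)| <= 2 ^ (q ^ 2 * C * q ^ l).
Proof.
move=> kq q1; elim: l => [|l IH].
  apply: leq_trans (_ : #|powerset (box 1)| <= _).
    by apply: subset_leq_card; apply/fintype.subsetP => M; rewrite !inE expn0 => /andP[].
  rewrite card_powerset expn0 muln1 leq_exp2l//.
  apply: (@leq_trans 1); last by rewrite muln_gt0 expn_gt0 q0.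
  apply/card_le1P => -[a b]; rewrite inE /= !ltnS !leqn0 => /andP[/eqP a0 /eqP b0] [a' b'].
  rewrite inE /= !ltnS !leqn0; apply/andP/eqP => [[/eqP a0' /eqP b0']|[-> ->]]; last by rewrite a0 b0.
  by congr pair; apply: val_inj; rewrite /= ?a0 ?b0.
have av M : M \in avoiders s (q ^ l.+1) -> cell @: M \in avoiders s (q ^ l).
  rewrite !inE expnS => /andP[Mb /asboolP nM]; apply/andP; split; first exact: cells_box.
  by apply/asboolP => /contains_cells.
rewrite -sum1_card (partition_big (fun M => cell @: M) (fun B => B \in avoiders s (q ^ l)) av) /=.
apply: leq_trans (_ : \sum_(B in avoiders s (q ^ l)) 2 ^ (q ^ 2 * C * q ^ l) <= _).
  apply: leq_sum => B; rewrite inE => /andP[Bb /asboolP nB].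
  apply: leq_trans (_ : #|powerset [set e | cell e \in B]| <= _).
    rewrite sum1_card; apply: subset_leq_card; apply/fintype.subsetP => M.
    move=> /andP[_ /eqP MB]; rewrite inE; apply/fintype.subsetP => e eM.
    by rewrite inE -MB imset_f.
  rewrite card_powerset leq_exp2l// -mulnA.
  apply: leq_trans (_ : q ^ 2 * #|B| <= _); last by rewrite leq_mul2l (marcus_tardos kq nB)// orbT.
  rewrite -sum1_card (@partition_big _ _ _ _ _ _ _ cell (fun e0 => e0 \in B)) /=; last by move=> e; rewrite inE.
  rewrite mulnC -sum_nat_const; apply: leq_sum => e0 eB; apply: leq_trans (card_cell e0).
  by rewrite sum1_card; apply: subset_leq_card; apply/fintype.subsetP => e; rewrite !inE => /andP[].
rewrite sum_nat_const; apply: leq_trans (leq_mul IH (leqnn _)) _.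
rewrite -expnD leq_exp2l// (expnS q l).
by move: (q ^ 2 * C) (q ^ l) => a b; have := leq_mul q1 (leqnn (a * b)); nia.
Qed.

End MarcusTardos.

(** * The mean length is at most of order the square root *)

Definition oneline n (p : 'S_n) : seq nat := map succn (word p).

Lemma word_inj n : injective (@word n).
Proof.
move=> p p' /eq_in_map e; apply/permP => i; apply: val_inj; apply: e.
by rewrite fintype.mem_enum.
Qed.

Lemma oneline_Sn n (p : 'S_n) : oneline p \in Sn n.
Proof.
rewrite mem_permutations; apply: uniq_perm; rewrite ?iota_uniq//.
  by rewrite map_inj_uniq ?uniq_word//; exact: succn_inj.
have u : uniq (oneline p) by rewrite map_inj_uniq ?uniq_word//; exact: succn_inj.
have [] // := @uniq_min_size _ (oneline p) (iota 1 n) u.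
  move=> _ /mapP[_ /mapP[i _ ->] ->]; rewrite mem_iota add1n ltnS /=; exact: ltn_ord.
by rewrite size_iota size_map size_word.
Qed.

Lemma Sn_oneline n : perm_eq (Sn n) [seq oneline p | p <- enum {: 'S_n}].
Proof.
have u : uniq [seq oneline p | p <- enum {: 'S_n}].
  rewrite map_inj_uniq ?enum_uniq// => p p' /inj_map/word_inj; apply.
  exact: succn_inj.
rewrite perm_sym; apply: uniq_perm; rewrite ?permutations_uniq//.
have [] // := uniq_min_size u (_ : {subset _ <= Sn n}).
  by move=> _ /mapP[p _ ->]; exact: oneline_Sn.
by rewrite size_permutations ?iota_uniq// size_iota size_map -cardE card_Sn.
Qed.

Lemma Sn_perm n s : s \in Sn n -> exists p : 'S_n, s = oneline p.
Proof. by rewrite (perm_mem (Sn_oneline n)) => /mapP[p _ ->]; exists p. Qed.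

Lemma pattern_of_oneline n (p : 'S_n) : pattern_of (word p) = oneline p.
Proof. by rewrite -(pattern_of_id (oneline_Sn p)) pattern_of_mono. Qed.

Section Growth.
Variables (A : set (seq nat)) (k : nat) (p : 'S_k).
Hypothesis Aavoid : forall s, A s -> ~ involved (oneline p) s.

(** Permutation matrices, placed in a corner of a larger square so that the size can
    be a power of [q]. *)
Definition permmx W K (KW : K <= W) (s : 'S_K) : {set 'I_W * 'I_W} :=
  [set (widen_ord KW i, widen_ord KW (s i)) | i : 'I_K].

Lemma contains_involved W K (KW : K <= W) (s : 'S_K) :
  contains p (permmx KW s) -> involved (oneline p) (pattern_of (word s)).
Proof.
case=> r [c [rm cm H]].
have /choice[x xE] i : exists x, r i = widen_ord KW x /\ c (p i) = widen_ord KW (s x).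
  by have /imsetP[x _ [-> ->]] := H i; exists x.
have xm : {homo x : i j / i < j}.
  by move=> i j /rm; case: (xE i) => -> _; case: (xE j) => -> _.
pose t := [seq x i | i <- enum 'I_k].
have /subseqP[m sm me] : subseq [seq val (s i) | i <- t] (word s).
  apply: map_subseq; rewrite -(filter_predT (enum 'I_K)).
  apply: subseq_enum_ord; last exact: all_predT.
  by rewrite /t sorted_map; apply: sub_sorted (sorted_enum_ord k) => i j /xm.
exists (mask m (pattern_of (word s))); first exact: mask_subseq.
rewrite pattern_of_mask -me /t -map_comp -(pattern_of_oneline p).
apply: pattern_of_eq => i j _ _ /=.
have e l : (s (x l) : nat) = c (p l) by case: (xE l) => _ ->.
rewrite !e; case: (ltngtP (p i) (p j)) => [/cm/ltnW//|/cm|/val_inj ->]; last by rewrite !leqnn.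
by rewrite ltnNge => /negbTE.
Qed.

Lemma class_growth : exists e, forall K, 0 < K ->
  #|[set s : 'S_K | `[< A (pattern_of (word s)) >]]| <= 2 ^ (e * K).
Proof.
(* Any [q] above [k.-1 ^ 2] would do. *)
pose q := k ^ 2 + 2; pose C := (2 * (k * 2 ^ q) * q ^ 2).+1.
have q1 : 1 < q by rewrite /q addn2.
have kq : k.-1 ^ 2 < q by rewrite /q addn2 ltnS leqW// leq_exp2r// leq_pred.
exists (q ^ 2 * C * q) => K K0.
have [l Kl lK] : exists2 l, K <= q ^ l & q ^ l <= q * K.
  exists (up_log q K); first exact: up_logP.
  have [K1|K1] := leqP K 1.
    by rewrite (_ : up_log q K = 0) ?expn0 ?muln_gt0 ?K0 ?(ltnW q1)//; apply/eqP; rewrite up_log_eq0 K1 orbT.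
  have /andP[lo _] := up_log_bounds q1 K1.
  by rewrite -(prednK (_ : 0 < up_log q K)) ?up_log_gt0// ?expnS ?leq_mul2l ?(ltnW lo) ?orbT// q1.
apply: leq_trans (_ : #|@avoiders (q ^ l) _ p (q ^ l)| <= _); last first.
  apply: leq_trans (@card_avoiders _ _ (ltnW q1) _ p l kq q1) _.
  by rewrite leq_exp2l// -[leqRHS]mulnA leq_mul2l lK orbT.
have inj : injective (@permmx _ _ Kl).
  move=> s s' e; apply/permP => i.
  have : (widen_ord Kl i, widen_ord Kl (s i)) \in permmx Kl s' by rewrite -e; apply: imset_f.
  by case/imsetP => j _ [] /val_inj -> /val_inj.
rewrite -(card_imset _ inj); apply: subset_leq_card; apply/fintype.subsetP => _ /imsetP[s + ->].
rewrite !inE => /asboolP As; apply/andP; split; last first.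
  apply/asboolP => /contains_involved; apply: Aavoid; exact/asboolP.
by apply/fintype.subsetP => _ /imsetP[i _ ->]; rewrite inE !ltn_ord.
Qed.

End Growth.

(** From [K ^ K <= (K + K) ^_ K] and ['C(K + K, K) <= 4 ^ K]. *)
Lemma expn_le_fact K : K ^ K <= 4 ^ K * K`!.
Proof.
have h m : K ^ m <= (K + m) ^_ m.
  elim: m => [|m IH]; first by rewrite ffactn0.
  by rewrite addnS ffactSS expnS leq_mul// -addnS leq_addr.
apply: leq_trans (h K) _; rewrite -bin_ffact leq_mul2r; apply/orP; right.
rewrite (_ : 4 ^ K = 2 ^ (K + K)); last by rewrite addnn -mul2n expnM.
have := Pascal 1 1 (K + K); rewrite addn1 => ->.
have KK : K < (K + K).+1 by rewrite ltnS leq_addr.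
rewrite (bigD1 (Ordinal KK))//=.
by rewrite !exp1n !muln1 leq_addr.
Qed.

Local Open Scope ring_scope.

Section UpperBound.
Variables (R : realType) (A : set (seq nat)).
Hypotheses (A0 : A [::])
  (Adown : forall s t : seq nat, A (pattern_of s) -> subseq t s -> A (pattern_of t)).

(** If the longest length is at least [K], some set [P] of [K] positions carries a
    pattern in the class; for a fixed [P] that pattern is uniform. *)
Lemma longest_tail n K e :
  (#|[set s : 'S_K | `[< A (pattern_of (word s)) >]]| <= e)%N ->
  \sum_(s : 'S_n) (K <= longest A (word s))%N%:R <= n`!%:R * ('C(n, K)%:R * (e%:R / K`!%:R)) :> R.
Proof.
move=> ce; pose g (s : seq nat) : R := (`[< A (pattern_of s) >])%:R.
have ginv : pattern_invariant g.
  by move=> s us; rewrite /g (pattern_of_id (pattern_of_Sn us)).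
have gK : avg g K <= e%:R / K`!%:R.
  rewrite ler_wpM2r ?invr_ge0// (_ : \sum_s _ = #|[set s : 'S_K | `[< A (pattern_of (word s)) >]]|%:R) ?ler_nat//.
  by rewrite -sum1_card natr_sum [RHS]big_mkcond; apply: eq_bigr => s _; rewrite inE /g; case: `[< _ >].
apply: le_trans (_ : \sum_(P : {set 'I_n} | #|P| == K) \sum_(s : 'S_n)
    g [seq val (s i) | i <- enum 'I_n & (i \in P) && (s i \in [set: 'I_n])] <= _); last first.
  rewrite (eq_bigr (fun=> n`!%:R * avg g K)); last first.
    move=> P /eqP PK; rewrite (sum_restrict_box ginv P [set: 'I_n] val_inj).
    rewrite (eq_bigr (fun=> avg g K)) ?sumr_const ?card_Sn ?[RHS]mulr_natl// => s _.
    by congr avg; rewrite -PK /boxcount; apply: eq_card => i; rewrite !inE andbT.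
  rewrite sumr_const -[leLHS]mulr_natl mulrCA ler_wpM2l// ler_pM//.
    by rewrite divr_ge0// sumr_ge0// => s _; rewrite /g.
  rewrite ler_nat -[n in 'C(n, _)]card_ord -(card_draws 'I_n K); apply: eq_leq.
  by apply: eq_card => P; rewrite inE.
rewrite exchange_big /=; apply: ler_sum => s _; have [KL|_] := leqP; last first.
  by apply: sumr_ge0 => P _; rewrite /g.
have [t [ts At tL]] := longest_ex A0 (word s).
pose u := take K t; have ut : subseq u t by apply: take_subseq.
have su : size u = K by rewrite size_takel// tL.
have /subseqP[m sm um] : subseq u (word s) by apply: subseq_trans ut ts.
rewrite size_word in sm.
pose P : {set 'I_n} := [set i : 'I_n | nth false m i].
have uE : [seq val (s i) | i <- enum 'I_n & (i \in P) && (s i \in [set: 'I_n])] = u.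
  rewrite um /word -map_mask; congr map.
  rewrite -[in RHS](mkseq_nth false m) sm /mkseq -val_enum_ord -map_comp -filter_mask.
  by apply: eq_filter => i; rewrite !inE andbT.
have Au : A (pattern_of u) by apply: Adown ut; exact: At.
rewrite (bigD1 P) /=; last first.
  rewrite -su -uE size_map size_filter_enum; apply/eqP.
  by congr #|pred_of_set _|; apply/setP => i; rewrite !inE andbT.
rewrite uE /g (_ : `[< _ >] = true); last exact/asboolP.
by rewrite lerDl sumr_ge0.
Qed.

(** Up to powers of a constant the union bound reads [(n / K ^ 2) ^ K], so that it is
    at most [2 ^ - K] once [K ^ 2] is a large multiple of [n]; the factor [n <= K ^ 2]
    that bounds the length on the exceptional event is then harmless. *)
Lemma expect_le n K e : (0 < K)%N -> (2 ^ (e + 5) * n <= K ^ 2)%N ->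
  (#|[set s : 'S_K | `[< A (pattern_of (word s)) >]]| <= 2 ^ (e * K))%N ->
  expect R A n <= 2 * K%:R.
Proof.
move=> K0 nK ce; have fn : 0 < n`!%:R :> R by rewrite ltr0n fact_gt0.
rewrite -(ler_pM2l fn) -sum_word.
apply: le_trans (_ : \sum_(s : 'S_n) (K%:R + n%:R * (K <= longest A (word s))%N%:R) <= _).
  apply: ler_sum => s _; rewrite /lenA; have [_|/ltnW LK] := leqP.
    rewrite mulr1 -natrD ler_nat; apply: leq_trans (longest_size _ _) _.
    by rewrite size_word leq_addl.
  by rewrite mulr0 addr0 ler_nat.
rewrite big_split /= sumr_const card_Sn -[X in X + _]mulr_natl -mulr_sumr.
apply: le_trans (_ : n`!%:R * K%:R + n%:R * (n`!%:R * ('C(n, K)%:R * ((2 ^ (e * K))%:R / K`!%:R))) <= _).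
  by rewrite lerD2l ler_wpM2l//; exact: longest_tail.
rewrite [n%:R * _]mulrCA -mulrDr ler_wpM2l ?(ltW fn)// [2 * _]mulr_natl mulr2n lerD2l.
have key : ('C(n, K) * 2 ^ (e * K) * 2 ^ K <= K`!)%N.
  rewrite -(leq_pmul2r (fact_gt0 K)) -(leq_pmul2r (_ : 0 < 4 ^ K * 4 ^ K))%N ?muln_gt0 ?expn_gt0//.
  apply: (@leq_trans (K ^ K * K ^ K)); last first.
    rewrite (_ : K`! * K`! * _ = (4 ^ K * K`!) * (4 ^ K * K`!))%N; last by ring.
    by rewrite leq_mul// expn_le_fact.
  rewrite (_ : _ * K`! * _ = ('C(n, K) * K`!) * (2 ^ (e + 5)) ^ K)%N; last first.
    have -> : ((2 ^ (e + 5)) ^ K = 2 ^ (e * K) * 2 ^ K * (4 ^ K * 4 ^ K))%N.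
      by rewrite expnD expnMn -expnM -mulnA -!expnMn.
    ring.
  rewrite bin_ffact -expnMn; apply: (@leq_trans ((2 ^ (e + 5) * n) ^ K)); last first.
    by rewrite leq_exp2r// mulnn.
  rewrite expnMn mulnC leq_mul2l; apply/orP; right.
  elim: (K) => [|m IH]; first by rewrite ffactn0.
  by rewrite ffactnSr expnSr leq_mul// leq_subr.
have n2 : (n <= K * 2 ^ K)%N.
  apply: (@leq_trans (K ^ 2)).
    by apply: leq_trans nK; rewrite leq_pmull// expn_gt0.
  by rewrite expnS expn1 leq_mul2l ltnW ?orbT// ltn_expl.
rewrite !mulrA ler_pdivrMr ?ltr0n ?fact_gt0// -!natrM ler_nat.
apply: leq_trans (_ : K * ('C(n, K) * 2 ^ (e * K) * 2 ^ K) <= _)%N; last by rewrite leq_mul2l key orbT.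
rewrite -mulnA [X in (_ <= X)%N](_ : _ = K * 2 ^ K * ('C(n, K) * 2 ^ (e * K)))%N; last by ring.
by rewrite leq_mul2r n2 orbT.
Qed.

Lemma sqrt_ceil n : (0 < n)%N -> exists t, [/\ (0 < t)%N, (n <= t ^ 2)%N & (t ^ 2 <= 4 * n)%N].
Proof.
move=> n0; have ex : exists t, (n <= t ^ 2)%N.
  by exists n; rewrite expnS expn1 leq_pmull.
case: (ex_minnP ex) => t nt tmin; exists t; split => //.
  by case: t nt {tmin} => // ; rewrite leqNgt n0.
have := tmin t.-1; rewrite leqNgt; have [t1|t1] := leqP t 1.
  by move=> _; apply: (@leq_trans 1); [rewrite (leq_exp2r _ 1)//|lia].
have := ltnP (t.-1 ^ 2) n; case=> [h _|_ /(_ isT)]; nia.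
Qed.

Lemma expect_sqrt k (p : 'S_k) : (forall s, A s -> ~ involved (oneline p) s) ->
  exists C : R, forall n, expect R A n <= C * Num.sqrt n%:R.
Proof.
move=> Aavoid; have [e eP] := class_growth Aavoid.
pose H := (2 ^ (e + 5))%N; have H0 : (0 < H)%N by rewrite expn_gt0.
exists (4 * H%:R) => n; have [->|n0] := posnP n.
  rewrite sqrtr0 mulr0 /expect /avg big1 ?mul0r// => s _; rewrite /lenA.
  by apply/eqP; rewrite pnatr_eq0 -leqn0 -[X in (_ <= X)%N](size_word s) longest_size.
have [t [t0 nt tn]] := sqrt_ceil n0.
have K0 : (0 < H * t)%N by rewrite muln_gt0 H0.
apply: le_trans (expect_le K0 _ (eP _ K0)) _.
  by rewrite expnMn leq_mul// expnS expn1 leq_pmulr.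
have : t%:R <= 2 * Num.sqrt n%:R :> R.
  rewrite -(ler_pXn2r (_ : 0 < 2)%N) ?nnegrE ?mulr_ge0 ?sqrtr_ge0//.
  by rewrite exprMn sqr_sqrtr// -natrX -natrX -natrM ler_nat.
have : 0 <= H%:R :> R by [].
rewrite natrM; nra.
Qed.
End UpperBound.

(** * Existence of the limit *)

Section Limit.
Local Open Scope classical_set_scope.
Variables (R : realType) (A : set (seq nat)) (C : R).
Hypotheses (A0 : A [::]) (sumA : sum_closed A).
Hypothesis fC : forall n, expect R A n <= C * Num.sqrt n%:R.

Definition scaled n : R := expect R A n / Num.sqrt n%:R.

Lemma scaled_ge0 n : 0 <= scaled n.
Proof. by rewrite divr_ge0 ?expect_ge0 ?sqrtr_ge0. Qed.

Lemma scaled_le n : (0 < n)%N -> scaled n <= C.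
Proof. by move=> n0; rewrite ler_pdivrMr ?sqrtr_gt0 ?ltr0n. Qed.

Lemma max_square n N : (0 < n)%N -> exists k, (k * (k * n) <= N < k.+1 * (k.+1 * n))%N.
Proof.
move=> n0; have ex : exists k, (k * (k * n) <= N)%N by exists 0%N.
have bd k : (k * (k * n) <= N)%N -> (k <= N)%N by nia.
case: (ex_maxnP ex bd) => k kN kmax; exists k; rewrite kN ltnNge.
by apply/negP => /kmax; rewrite ltnn.
Qed.

(** [expect_super] with boxes that contain [m + m / L] points on average: the surplus
    [m / L] exceeds the standard deviation for large [m] and costs a factor close
    to 1; the two other factors [1 - 1 / L] come from the probability bound and from the
    replacement of [N] by the largest [k * (k * n)] below it. *)
Lemma scaled_almost_mono L m N : (0 < L)%N -> (4 * L ^ 3 <= m)%N ->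
  (L ^ 2 * (2 * m) <= N)%N -> (1 - L%:R^-1) ^+ 3 * scaled m <= scaled N.
Proof.
move=> L0 Lm LN; set x := L%:R^-1 : R.
pose d := (m %/ L)%N; pose n := (m + d)%N.
have dL : (4 * L ^ 2 <= d)%N by rewrite leq_divRL// -mulnA -expnSr.
have dm : (d * L <= m)%N by exact: leq_trunc_div.
have md : (m < d.+1 * L)%N by exact: ltn_ceil.
have d0 : (0 < d)%N by apply: leq_trans dL; rewrite muln_gt0 expn_gt0 L0.
have m0 : (0 < m)%N by nia.
have n0 : (0 < n)%N by rewrite addn_gt0 m0.
have Lnd : (L * n <= d ^ 2)%N by rewrite /n expnS expn1 in dL *; nia.
have [k /andP[kN Nk]] := max_square N n0.
have Lk : (L <= k)%N.
  rewrite leqNgt; apply/negP => kL; move: Nk; apply/negP; rewrite -leqNgt.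
  apply: leq_trans LN; rewrite mulnA mulnn leq_mul ?leq_exp2r//.
  by rewrite /n mul2n -addnn leq_add2l leq_div.
have x01 : 0 <= 1 - x by rewrite subr_ge0 invf_le1 ?ltr0n ?ler1n.
have h1 : 1 - x <= k%:R / k.+1%:R.
  rewrite ler_pdivlMr// -natr1 mulrBl mul1r -addrA gerDl subr_le0 mulrDr mulr1.
  have : 1 <= x * k%:R by rewrite mulrC ler_pdivlMr ?ltr0n// mul1r ler_nat.
  have : 0 <= x by rewrite invr_ge0.
  lra.
have h2 : 1 - x <= 1 - n%:R / (n%:R - m%:R) ^+ 2.
  rewrite lerB// /n natrD addrAC subrr add0r ler_pdivrMr ?exprn_gt0 ?ltr0n//.
  by rewrite mulrC ler_pdivlMr ?ltr0n// mulrC -natrD -natrX -natrM ler_nat.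
have sm : 0 < Num.sqrt m%:R :> R by rewrite sqrtr_gt0 ltr0n.
have sn : 0 < Num.sqrt n%:R :> R by rewrite sqrtr_gt0 ltr0n.
have h3 : 1 - x <= Num.sqrt m%:R / Num.sqrt n%:R.
  apply: le_trans (_ : m%:R / n%:R <= _).
    rewrite ler_pdivlMr ?ltr0n// mulrBl mul1r lerBlDr {1}/n natrD lerD2l.
    rewrite [x * _]mulrC ler_pdivlMr ?ltr0n// -natrM -natrD ler_nat.
    by rewrite (leq_trans dm)// leq_addr.
  rewrite -[X in X / _](sqr_sqrtr (ler0n R m)) -[X in _ / X](sqr_sqrtr (ler0n R n)).
  rewrite -expr_div_n expr2 ler_piMr ?divr_ge0 ?(ltW sm) ?(ltW sn)// ler_pdivrMr// mul1r.
  by rewrite ler_wsqrtr// ler_nat leq_addr.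
have sN : Num.sqrt N%:R <= k.+1%:R * Num.sqrt n%:R :> R.
  rewrite -(ler_pXn2r (_ : 0 < 2)%N) ?nnegrE ?mulr_ge0 ?sqrtr_ge0//.
  rewrite exprMn !sqr_sqrtr// -natrX -natrM ler_nat ltnW// expnS expn1 -mulnA//.
have N0 : (0 < N)%N by apply: leq_trans kN; rewrite !muln_gt0 n0 (leq_trans L0 Lk).
have sN0 : 0 < Num.sqrt N%:R :> R by rewrite sqrtr_gt0 ltr0n.
have fN : k%:R * (expect R A m * (1 - n%:R / (n%:R - m%:R) ^+ 2)) <= expect R A N.
  apply: le_trans (expect_mono R A0 kN); apply: expect_super => //.
  by rewrite /n -[X in (X < _)%N]addn0 ltn_add2l.
rewrite [leRHS]/scaled ler_pdivlMr//; apply: le_trans fN.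
have fm : expect R A m = scaled m * Num.sqrt m%:R by rewrite divfK// gt_eqF.
have gm := scaled_ge0 m.
apply: le_trans (_ : (1 - x) ^+ 3 * scaled m * (k.+1%:R * Num.sqrt n%:R) <= _).
  by rewrite ler_wpM2l// mulr_ge0 ?exprn_ge0.
rewrite fm.
move: h1 h3; rewrite !ler_pdivlMr ?ltr0n// => h1 h3.
have -> : (1 - x) ^+ 3 * scaled m * (k.+1%:R * Num.sqrt n%:R) =
  scaled m * (((1 - x) * k.+1%:R) * (((1 - x) * Num.sqrt n%:R) * (1 - x))) by ring.
rewrite -[leRHS](_ : scaled m * (k%:R * (Num.sqrt m%:R * (1 - n%:R / (n%:R - m%:R) ^+ 2))) = _); last by ring.
have y0 : 0 <= (1 - x) * Num.sqrt n%:R by rewrite mulr_ge0// ltW.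
apply: ler_wpM2l => //; apply: ler_pM => //; [exact: mulr_ge0|exact: mulr_ge0|].
exact: ler_pM.
Qed.

(** The limit is the upper limit, that is, the supremum of the numbers that the
    sequence reaches infinitely often. *)
Lemma scaled_cvg : exists2 l : R, 0 <= l & scaled @ \oo --> l.
Proof.
pose E : set R := [set x | forall n, exists2 m, (n <= m)%N & x <= scaled m].
have E0 : E 0 by move=> n; exists n => //; exact: scaled_ge0.
have Eub : ubound E C.
  by move=> x /(_ 1%N)[m m0 xm]; apply: le_trans xm (scaled_le _).
have supE : has_sup E by split; [exists 0|exists C].
exists (sup E); first exact: sup_upper_bound.
have C0 : 0 <= C by exact: Eub.
apply/cvgrPdist_le => eps e0.
have [L L0 Le] : exists2 L, (0 < L)%N & 3 * C * L%:R^-1 <= eps / 2.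
  have C6 : 0 <= 6 * C / eps by rewrite divr_ge0 ?mulr_ge0// ltW.
  have B := archi_boundP C6.
  have B0 : 0 < (Num.bound (6 * C / eps))%:R :> R by exact: le_lt_trans B.
  exists (Num.bound (6 * C / eps)); first by rewrite -(ltr0n R).
  rewrite ler_pdivrMr//; move: B; rewrite ltr_pdivrMr//.
  by move: (Num.bound _)%:R => z; lra.
have e20 : 0 < eps / 2 by rewrite divr_gt0.
have [x Ex xE] := sup_adherent e20 supE.
have [m Lm xm] := Ex (4 * L ^ 3)%N.
have [n nP] : exists n, forall m, (n <= m)%N -> scaled m <= sup E + eps.
  apply: contrapT => /forallNP H.
  have : E (sup E + eps).
    move=> n; have /existsNP[m' /not_implyP[nm /negP]] := H n.
    by rewrite -ltNge => /ltW; exists m'.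
  by move/(sup_upper_bound supE); rewrite gerDl leNgt e0.
near=> N.
have nN : (n <= N)%N by near: N; exact: nbhs_infty_ge.
have LN : (L ^ 2 * (2 * m) <= N)%N by near: N; exact: nbhs_infty_ge.
have := scaled_almost_mono L0 Lm LN; have := nP _ nN.
rewrite ler_distlC.
have y0 : 0 <= L%:R^-1 :> R by rewrite invr_ge0.
have y1 : L%:R^-1 <= 1 :> R by rewrite invf_le1 ?ltr0n ?ler1n.
move: (L%:R^-1) Le y0 y1 => y Le y0 y1.
have sC : scaled m <= C.
  by apply: scaled_le; apply: leq_trans Lm; rewrite muln_gt0 expn_gt0 L0.
have cube : 1 - 3 * y <= (1 - y) ^+ 3.
  rewrite -subr_ge0 (_ : _ - _ = y ^+ 2 * (3 - y)); last by ring.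
  by rewrite mulr_ge0 ?exprn_ge0//; lra.
have gm := scaled_ge0 m.
have : (1 - 3 * y) * scaled m <= (1 - y) ^+ 3 * scaled m by rewrite ler_wpM2r.
have : 3 * y * scaled m <= 3 * C * y by nra.
move=> *; apply/andP; split; lra.
Unshelve. all: by end_near.
Qed.

End Limit.

(** * Finitely supported distributions *)

Section Dist.
Variable R : realType.

(** A finitely supported law is a list of weighted values, so that exchanging
    expectations is exchanging finite sums. *)
Definition mean T (d : seq (R * T)) (h : T -> R) : R := \sum_(e <- d) e.1 * h e.2.

Definition prob T (d : seq (R * T)) := all (fun e => 0 <= e.1) d /\ \sum_(e <- d) e.1 = 1.

Definition supp T (d : seq (R * T)) (P : pred T) := all (fun e => P e.2) d.

Lemma meanD T (d : seq (R * T)) g h : mean d (fun x => g x + h x) = mean d g + mean d h.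
Proof. by rewrite -big_split; apply: eq_bigr => e _; rewrite mulrDr. Qed.

Lemma meanZ T (d : seq (R * T)) c h : mean d (fun x => c * h x) = c * mean d h.
Proof. by rewrite mulr_sumr; apply: eq_bigr => e _; rewrite mulrCA. Qed.

Lemma meanC T (d : seq (R * T)) c : prob d -> mean d (fun=> c) = c.
Proof. by case=> _ d1; rewrite /mean -mulr_suml d1 mul1r. Qed.

Lemma mean_sum T (d : seq (R * T)) I (r : seq I) (P : pred I) (h : I -> T -> R) :
  mean d (fun x => \sum_(i <- r | P i) h i x) = \sum_(i <- r | P i) mean d (h i).
Proof. by rewrite exchange_big; apply: eq_bigr => e _; rewrite mulr_sumr. Qed.

Lemma eq_mean T (d : seq (R * T)) g h : g =1 h -> mean d g = mean d h.
Proof. by move=> gh; apply: eq_bigr => e _; rewrite gh. Qed.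

Lemma mean_exchange T U (d : seq (R * T)) (d' : seq (R * U)) (h : T -> U -> R) :
  mean d (fun x => mean d' (h x)) = mean d' (fun y => mean d (h^~ y)).
Proof.
rewrite /mean (eq_bigr (fun e => \sum_(e' <- d') e.1 * (e'.1 * h e.2 e'.2))).
  by rewrite exchange_big; apply: eq_bigr => e _; rewrite mulr_sumr; apply: eq_bigr => e' _; rewrite mulrCA.
by move=> e _; rewrite mulr_sumr.
Qed.

Lemma mean_le_supp T (d : seq (R * T)) P g h : prob d -> supp d P ->
  (forall x, P x -> g x <= h x) -> mean d g <= mean d h.
Proof.
case=> d0 _ sP gh; rewrite /mean; elim: d d0 sP => [|e d IH] /=; first by rewrite !big_nil.
move=> /andP[e0 d0] /andP[eP sP]; rewrite !big_cons lerD//; last exact: IH.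
by rewrite ler_wpM2l// gh.
Qed.

Lemma mean_le T (d : seq (R * T)) g h : prob d -> (forall x, g x <= h x) -> mean d g <= mean d h.
Proof.
by move=> pd gh; apply: (@mean_le_supp _ _ predT) => //; rewrite /supp all_predT.
Qed.

Fixpoint iid T (d : seq (R * T)) n : seq (R * seq T) :=
  if n is n'.+1 then [seq (e.1 * f.1, e.2 :: f.2) | e <- d, f <- iid d n']
  else [:: (1, [::])].

Lemma mean_iid0 T (d : seq (R * T)) h : mean (iid d 0) h = h [::].
Proof. by rewrite /mean /= big_seq1 mul1r. Qed.

Lemma mean_iidS T (d : seq (R * T)) n h :
  mean (iid d n.+1) h = mean d (fun x => mean (iid d n) (fun s => h (x :: s))).
Proof.
rewrite /mean /= big_allpairs_dep; apply: eq_bigr => e _.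
by rewrite mulr_sumr; apply: eq_bigr => f _; rewrite mulrA.
Qed.

Lemma all_flatten T (P : pred T) ss : all P (flatten ss) = all (all P) ss.
Proof. by elim: ss => //= s ss IH; rewrite all_cat IH. Qed.

Lemma prob_iid T (d : seq (R * T)) n : prob d -> prob (iid d n).
Proof.
move=> pd; split.
  elim: n => [|n IH] /=; first by rewrite ler01.
  rewrite all_flatten all_map; apply: sub_all pd.1 => e e0 /=; rewrite all_map.
  by apply: sub_all IH => f f0 /=; exact: mulr_ge0.
have -> : \sum_(e <- iid d n) e.1 = mean (iid d n) (fun=> 1).
  by apply: eq_bigr => e _; rewrite mulr1.
elim: n => [|n IH]; first by rewrite mean_iid0.
by rewrite mean_iidS (eq_mean _ (fun=> IH)) meanC.
Qed.

Lemma supp_iid T (d : seq (R * T)) P n : supp d P ->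
  supp (iid d n) (fun s => (size s == n) && all P s).
Proof.
move=> sP; elim: n => [|n IH]; first by [].
rewrite /supp /= all_flatten all_map; apply: sub_all sP => e eP /=; rewrite all_map.
by apply: sub_all IH => f /=; rewrite eqSS eP.
Qed.

Lemma mean_iid_drop T (d : seq (R * T)) n m h : prob d ->
  mean (iid d n) (fun s => h (drop m s)) = mean (iid d (n - m)) h.
Proof.
move=> pd; elim: n m => [|n IH] [|m]; first by rewrite !mean_iid0.
- by rewrite !mean_iid0.
- by apply: eq_mean => s; rewrite drop0.
- by rewrite subSS mean_iidS /= (eq_mean _ (fun=> IH m)) meanC.
Qed.

Lemma mean_iid_take T (d : seq (R * T)) n m h : prob d ->
  mean (iid d n) (fun s => h (take m s)) = mean (iid d (minn m n)) h.
Proof.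
move=> pd; elim: n m h => [|n IH] [|m] h; first by rewrite !mean_iid0.
- by rewrite minn0 !mean_iid0.
- rewrite min0n mean_iid0 (eq_mean _ (fun s => congr1 h (take0 s))) meanC//; exact: prob_iid.
- by rewrite minnSS !mean_iidS; apply: eq_mean => x /=; rewrite (IH m (fun s => h (x :: s))).
Qed.

Lemma mean_iid_nth T (d : seq (R * T)) x0 n c h : prob d -> (c < n)%N ->
  mean (iid d n) (fun s => h (nth x0 s c)) = mean d h.
Proof.
move=> pd; elim: n c => [//|n IH] [_|c cn]; rewrite mean_iidS /=.
  by apply: eq_mean => x; rewrite meanC//; exact: prob_iid.
by rewrite IH// meanC.
Qed.

Lemma mean_iid_map T (d : seq (R * T)) U (d' : seq (R * U)) (phi : T -> U) n h :
  (forall g, mean d (fun x => g (phi x)) = mean d' g) ->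
  mean (iid d n) (fun s => h (map phi s)) = mean (iid d' n) h.
Proof.
move=> dphi; elim: n h => [|n IH] h; first by rewrite !mean_iid0.
rewrite !mean_iidS -[RHS]dphi; apply: eq_mean => x /=.
by rewrite (IH (fun s => h (phi x :: s))).
Qed.

Lemma mean_iid_mean T (d : seq (R * T)) n g : prob d ->
  mean (iid d n) (fun s => \sum_(x <- s) g x) = n%:R * mean d g.
Proof.
move=> pd; elim: n => [|n IH]; first by rewrite mean_iid0 big_nil mul0r.
rewrite mean_iidS (@eq_mean _ _ _ (fun x => g x + n%:R * mean d g)); last first.
  move=> x; under eq_mean => s do rewrite big_cons.
  by rewrite meanD meanC ?IH//; exact: prob_iid.
by rewrite meanD meanC// -natr1; ring.
Qed.

Lemma mean_iid_var T (d : seq (R * T)) n g (mu := mean d g) : prob d ->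
  mean (iid d n) (fun s => (\sum_(x <- s) g x - n%:R * mu) ^+ 2) =
  n%:R * mean d (fun x => (g x - mu) ^+ 2).
Proof.
move=> pd; set v := mean d _; elim: n => [|n IH].
  by rewrite mean_iid0 big_nil !mul0r subr0 expr0n.
rewrite mean_iidS (@eq_mean _ _ _ (fun x => (g x - mu) ^+ 2 + n%:R * v)); last first.
  move=> x; have pn := prob_iid n pd.
  under eq_mean => s.
    rewrite big_cons (_ : (g x + \sum_(x <- s) g x - n.+1%:R * mu) ^+ 2 =
      (g x - mu) ^+ 2 + 2 * (g x - mu) * (\sum_(x <- s) g x + - (n%:R * mu)) +
      (\sum_(x <- s) g x - n%:R * mu) ^+ 2); last by rewrite -natr1; ring.
    over.
  by rewrite !meanD meanZ meanD !meanC// mean_iid_mean// subrr mulr0 addr0 IH.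
by rewrite meanD meanC// -/v -natr1; ring.
Qed.

(** Bounded differences: revealing the entries one by one gives a martingale
    whose increments are at most [1] in absolute value. *)
Lemma mean_iid_lipschitz T (d : seq (R * T)) n (h : seq T -> R) (m := mean (iid d n) h) :
  prob d -> (forall s1 s2 x y, h (s1 ++ x :: s2) <= h (s1 ++ y :: s2) + 1) ->
  mean (iid d n) (fun s => (h s - m) ^+ 2) <= n%:R.
Proof.
move=> pd; rewrite {}/m; elim: n h => [|n IH] h hL.
  by rewrite !mean_iid0 subrr expr0n.
have pn := prob_iid n pd.
pose mx x := mean (iid d n) (fun s => h (x :: s)).
have -> : mean (iid d n.+1) h = mean d mx by rewrite mean_iidS.
set m := mean d mx.
have mxm x : -1 <= mx x - m <= 1.
  have mxy y z : mx y <= mx z + 1.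
    rewrite -(meanC 1 pn) -meanD; apply: mean_le => // s; exact: (hL [::]).
  apply/andP; split.
    rewrite lerBrDr addrC lerBlDr -(meanC (mx x + 1) pd); exact: mean_le.
  rewrite lerBlDr addrC -(meanC 1 pd) -meanD -[leLHS](meanC (mx x) pd); exact: mean_le.
rewrite mean_iidS; apply: le_trans (_ : mean d (fun x => n%:R + 1) <= _); last first.
  by rewrite meanC// natr1.
apply: mean_le => // x.
under eq_mean => s.
  rewrite (_ : (h (x :: s) - m) ^+ 2 = (h (x :: s) - mx x) ^+ 2 +
     2 * (mx x - m) * (h (x :: s) + - mx x) + (mx x - m) ^+ 2); last by ring.
  over.
rewrite !meanD meanZ meanD !meanC// subrr mulr0 addr0 lerD//.
  by apply: (IH (fun s => h (x :: s))) => s1 s2 y z; exact: (hL (x :: s1)).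
by have /andP[] := mxm x; nra.
Qed.

Definition prod T U (d : seq (R * T)) (d' : seq (R * U)) : seq (R * (T * U)) :=
  [seq (e.1 * f.1, (e.2, f.2)) | e <- d, f <- d'].

Lemma mean_prod T U (d : seq (R * T)) (d' : seq (R * U)) h :
  mean (prod d d') h = mean d (fun x => mean d' (fun y => h (x, y))).
Proof.
rewrite /mean big_allpairs_dep; apply: eq_bigr => e _.
by rewrite mulr_sumr; apply: eq_bigr => f _; rewrite mulrA.
Qed.

Lemma mean_fst T U (d : seq (R * T)) (d' : seq (R * U)) h : prob d' ->
  mean (prod d d') (fun z => h z.1) = mean d h.
Proof. by move=> pd'; rewrite mean_prod; apply: eq_mean => x; exact: (meanC (h x) pd'). Qed.

Lemma mean_snd T U (d : seq (R * T)) (d' : seq (R * U)) h : prob d ->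
  mean (prod d d') (fun z => h z.2) = mean d' h.
Proof. by move=> pd; rewrite mean_prod; exact: (meanC (mean d' h) pd). Qed.

Lemma prob_prod T U (d : seq (R * T)) (d' : seq (R * U)) :
  prob d -> prob d' -> prob (prod d d').
Proof.
move=> pd pd'; split.
  rewrite all_flatten all_map; apply: sub_all pd.1 => e e0 /=; rewrite all_map.
  by apply: sub_all pd'.1 => f f0 /=; exact: mulr_ge0.
have -> : \sum_(e <- prod d d') e.1 = mean (prod d d') (fun=> 1).
  by apply: eq_bigr => e _; rewrite mulr1.
by rewrite mean_prod (eq_mean _ (fun=> meanC 1 pd')) meanC.
Qed.

Lemma supp_prod T U (d : seq (R * T)) (d' : seq (R * U)) P Q :
  supp d P -> supp d' Q -> supp (prod d d') (fun z => P z.1 && Q z.2).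
Proof.
move=> sP sQ; rewrite /supp /prod all_flatten all_map; apply: sub_all sP => e eP /=.
by rewrite all_map; apply: sub_all sQ => f fQ /=; rewrite eP.
Qed.

(** For finitely many variables of small variance, the mean of the maximum is close to
    the maximum of the means: [e <= q / 2 + e ^ 2 / (2 * q)] bounds each deviation [e],
    and the squares may be added up. *)
Lemma mean_max T (d : seq (R * T)) (P : pred T) (I : finType) (Y : I -> T -> R) V M v q :
  prob d -> supp d P -> 0 < q ->
  (forall x, P x -> exists i, V x <= Y i x) ->
  (forall i, mean d (Y i) <= M) ->
  (forall i, mean d (fun x => (Y i x - mean d (Y i)) ^+ 2) <= v) ->
  mean d V <= M + (q + #|I|%:R * v / q) / 2.
Proof.
move=> pd sP q0 VY YM Yv.
apply: le_trans (_ : mean d (fun x => (M + q / 2) + (2 * q)^-1 * \sum_i (Y i x - mean d (Y i)) ^+ 2) <= _).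
  apply: (mean_le_supp pd sP) => x /VY[i Vi]; apply: le_trans Vi _.
  set e := Y i x - mean d (Y i).
  have : e ^+ 2 <= \sum_i (Y i x - mean d (Y i)) ^+ 2.
    by rewrite (bigD1 i)//= lerDl sumr_ge0// => j _; rewrite sqr_ge0.
  move: (\sum_i _) => s es.
  have ie : e <= q / 2 + (2 * q)^-1 * e ^+ 2.
    rewrite -subr_ge0 (_ : _ - _ = (2 * q)^-1 * (e - q) ^+ 2); last by field; rewrite gt_eqF.
    by rewrite mulr_ge0 ?sqr_ge0// invr_ge0 mulr_ge0// ltW.
  have : (2 * q)^-1 * e ^+ 2 <= (2 * q)^-1 * s.
    by rewrite ler_wpM2l// invr_ge0 mulr_ge0// ltW.
  by have := YM i; rewrite /e in ie *; lra.
rewrite meanD meanC// meanZ mean_sum -addrA lerD2l.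
have -> : (q + #|I|%:R * v / q) / 2 = q / 2 + (2 * q)^-1 * (#|I|%:R * v).
  by field; rewrite gt_eqF.
rewrite lerD2l ler_wpM2l//; first by rewrite invr_ge0 mulr_ge0// ltW.
by rewrite -sum1_card natr_sum mulr_suml; apply: ler_sum => i _; rewrite mul1r.
Qed.

Definition bern (p : R) : seq (R * bool) := [:: (p, true); (1 - p, false)].

Lemma prob_bern p : 0 <= p <= 1 -> prob (bern p).
Proof.
move=> /andP[p0 p1]; split; first by rewrite /= p0 subr_ge0 p1.
by rewrite !big_cons big_nil addr0 addrC subrK.
Qed.

Lemma mean_bern p h : mean (bern p) h = p * h true + (1 - p) * h false.
Proof. by rewrite /mean !big_cons big_nil addr0. Qed.

Lemma count_sum (s : seq bool) : (count id s)%:R = \sum_(x <- s) x%:R :> R.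
Proof. by rewrite -sum1_count natr_sum big_mkcond; apply: eq_bigr => -[]. Qed.

Lemma mean_count p n : 0 <= p <= 1 -> mean (iid (bern p) n) (fun s => (count id s)%:R) = n%:R * p.
Proof.
move=> p01; rewrite (eq_mean _ count_sum) mean_iid_mean; last exact: prob_bern.
by rewrite mean_bern mulr1 mulr0 addr0.
Qed.

Lemma mean_count_var p n : 0 <= p <= 1 ->
  mean (iid (bern p) n) (fun s => ((count id s)%:R - n%:R * p) ^+ 2) = n%:R * (p * (1 - p)).
Proof.
move=> p01; have := mean_iid_var n (fun x : bool => x%:R : R) (prob_bern p01).
have -> : mean (bern p) (fun x : bool => x%:R) = p by rewrite mean_bern mulr1 mulr0 addr0.
rewrite mean_bern => e.
by under eq_mean do rewrite count_sum; rewrite e /=; ring.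
Qed.

Lemma sum_tuple_cons (T : finType) n (F : seq T -> R) :
  \sum_(t : n.+1.-tuple T) F t = \sum_(x : T) \sum_(t : n.-tuple T) F (x :: t).
Proof.
rewrite pair_big /= (reindex (fun p : T * n.-tuple T => cons_tuple p.1 p.2)) //=.
exists (fun t : n.+1.-tuple T => (thead t, behead_tuple t)) => [[x t] _|t _] /=.
  by rewrite theadE; congr pair; apply: val_inj.
by rewrite [RHS]tuple_eta; apply: val_inj.
Qed.

Lemma mean_iid_bern p n h : mean (iid (bern p) n) h =
  \sum_(t : n.-tuple bool) p ^+ count id t * (1 - p) ^+ count negb t * h t.
Proof.
elim: n h => [|n IH] h.
  rewrite mean_iid0 (big_pred1 [tuple]) ?mul1r ?expr0// => t.
  by apply/esym/eqP; rewrite tuple0.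
rewrite mean_iidS mean_bern !IH.
rewrite (sum_tuple_cons _ (fun t => p ^+ count id t * (1 - p) ^+ count negb t * h t)).
rewrite big_bool /= !mulr_sumr; congr (_ + _); apply: eq_bigr => t _.
  by rewrite add1n add0n exprS; ring.
by rewrite add1n add0n exprS; ring.
Qed.

(** The weight of a sequence of bits depends only on the numbers of its ones and zeros. *)
Lemma mean_iid_perm p n (s : 'S_n) h :
  mean (iid (bern p) n) (fun r => h [seq nth false r (s i) | i <- enum 'I_n]) =
  mean (iid (bern p) n) h.
Proof.
rewrite !mean_iid_bern; pose f (u : 'S_n) (t : n.-tuple bool) := [tuple tnth t (u i) | i < n].
have fK u : cancel (f u) (f u^-1%g).
  by move=> t; apply: eq_from_tnth => i; rewrite !tnth_mktuple permKV.
rewrite [RHS](reindex_inj (can_inj (fK s))); apply: eq_bigr => t _.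
have fE : [seq nth false t (s i) | i <- enum 'I_n] = f s t.
  by rewrite /= -val_ord_tuple; apply: eq_map => i; rewrite (tnth_nth false).
have pt : perm_eq (f s t) t.
  apply/tuple_permP; exists s; congr tval; apply: eq_from_tnth => i; by rewrite !tnth_mktuple.
by rewrite fE !(seq.permP pt).
Qed.

End Dist.

(** * Hammersley's process on a grid with sources and sinks *)

(** Last-passage percolation, row by row. The lists [xs] and [rowstep y xs rs] are the
    horizontal increments of the last-passage function [l] along the lower and the
    upper side of a row, [rs] marks the cells of the row and [y] is the increment on
    its left side. With [m] the maximum of [x], [y] and [r], the rule
    [l(i+1, j+1) = max (l(i, j+1), l(i+1, j), l(i, j) + r)] sends the increments
    [x], [y] to [m - y] and [m - x]. *)
Fixpoint rowstep (y : bool) (xs rs : seq bool) : seq bool :=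
  match xs, rs with
  | x :: xs', r :: rs' => let m := [|| x, y | r] in
      (m && ~~ y) :: rowstep (m && ~~ x) xs' rs'
  | _, _ => [::]
  end.

Fixpoint profile (xs ys : seq bool) (w : seq (seq bool)) : seq bool :=
  match ys, w with
  | y :: ys', r :: w' => profile (rowstep y xs r) ys' w'
  | _, _ => xs
  end.

Section Stationarity.
Variables (R : realType) (al be p : R).
Hypothesis balance : al * be = p * (1 - al) * (1 - be).

(** The outcome [(1, 1)] arises from [(0, 0)] at a marked cell only and the outcome
    [(0, 0)] arises from [(1, 1)]; the pairs [(0, 1)] and [(1, 0)] are left unchanged. The
    balance equation says that these two exchanges have the same probability. *)
Lemma cell_stationary (g : bool -> bool -> R) :
  mean (bern be) (fun y => mean (bern al) (fun x => mean (bern p) (fun r =>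
    g ([|| x, y | r] && ~~ y) ([|| x, y | r] && ~~ x)))) =
  mean (bern al) (fun x => mean (bern be) (fun y => g x y)).
Proof.
rewrite !mean_bern /=; apply/eqP; rewrite -subr_eq0 [X in X == _](_ : _ =
  (p * (1 - al) * (1 - be) - al * be) * (g true true - g false false)); last by ring.
by rewrite balance subrr mul0r eqxx.
Qed.

(** Cell after cell, the left increment and the remaining lower increments stay
    independent of the upper increments already produced. *)
Lemma row_stationary n (h : seq bool -> R) :
  mean (bern be) (fun y => mean (iid (bern al) n) (fun xs => mean (iid (bern p) n) (fun rs =>
    h (rowstep y xs rs)))) = mean (iid (bern al) n) h.
Proof.
elim: n h => [|n IH] h.
  under eq_mean do rewrite mean_iid0 mean_iid0.
  by rewrite mean_iid0 mean_bern /=; ring.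
under eq_mean => y.
  rewrite mean_iidS; under eq_mean => x.
    under eq_mean => xs do rewrite mean_iidS.
    rewrite mean_exchange; over.
  over.
rewrite (cell_stationary (fun x y => mean (iid (bern al) n) (fun xs =>
  mean (iid (bern p) n) (fun rs => h (x :: rowstep y xs rs))))).
by rewrite mean_iidS; apply: eq_mean => x; exact: (IH (fun s => h (x :: s))).
Qed.

Lemma profile_stationary a b (h : seq bool -> R) :
  mean (iid (bern al) a) (fun xs => mean (iid (bern be) b) (fun ys =>
    mean (iid (iid (bern p) a) b) (fun w => h (profile xs ys w)))) =
  mean (iid (bern al) a) h.
Proof.
elim: b => [|b IH]; first by apply: eq_mean => xs; rewrite !mean_iid0.
rewrite -[RHS]IH -[RHS]row_stationary [RHS]mean_exchange; apply: eq_mean => xs.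
rewrite mean_iidS; apply: eq_mean => y.
under eq_mean do rewrite mean_iidS.
by rewrite mean_exchange.
Qed.

End Stationarity.

Local Open Scope nat_scope.

Lemma size_rowstep y xs rs : size xs = size rs -> size (rowstep y xs rs) = size xs.
Proof. by elim: xs y rs => [|x xs IH] y [|r rs] //= [] /IH ->. Qed.

(** The recursion of the last-passage function, with [U i] its value on the upper side
    of a row relative to the lower left corner. *)
Lemma rowstep_max (y : bool) (xs rs : seq bool) i (U := fun i => y + count id (take i (rowstep y xs rs))) :
  size xs = size rs -> i < size xs ->
  U i.+1 = maxn (U i) (maxn (count id (take i.+1 xs)) (count id (take i xs) + nth false rs i)).
Proof.
rewrite {}/U; elim: xs y rs i => [//|x xs IH] y [//|r rs] [|i] [] sxr ix.
  by rewrite /= !take0 /=; move: x y r {sxr ix} => [] [] [].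
have := IH ([|| x, y | r] && ~~ x) rs i sxr ix.
rewrite [rowstep y _ _]/= !take_cons /=.
move: (count id (take i.+1 (rowstep _ _ _))) (count id (take i (rowstep _ _ _))).
move: (count id (take i.+1 xs)) (count id (take i xs)) (nth false rs i : nat) => c1 c2 c3 d1 d2.
by move: x y r {sxr ix} => [] [] [] /=; lia.
Qed.

Section Exit.
Variables (S T : seq bool) (w : seq (seq bool)).

Definition occupied (e : nat * nat) := nth false (nth [::] w e.2) e.1.

(** Grid points are pairs (column, row). *)
Definition below (e f : nat * nat) := (e.1 < f.1) && (e.2 < f.2).

Lemma below_trans : transitive below.
Proof. by move=> f e g /andP[a b] /andP[c d]; rewrite /below !(ltn_trans a, ltn_trans b). Qed.

Definition chain (c : seq (nat * nat)) := sorted below c && all occupied c.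

(** Some path to the corner [(i, j)] has length at least [v]: it collects the sources
    (or the sinks) up to [z] and then follows a chain in the rest of the rectangle. *)
Definition exits i j v : Prop :=
  (exists z c, [/\ z <= i, chain c, all (fun e => (z <= e.1 < i) && (e.2 < j)) c &
     v <= count id (take z S) + size c]) \/
  (exists z c, [/\ z <= j, chain c, all (fun e => (e.1 < i) && (z <= e.2 < j)) c &
     v <= count id (take z T) + size c]).

Lemma exits_mono i j v i' j' v' : i <= i' -> j <= j' -> v' <= v ->
  exits i j v -> exits i' j' v'.
Proof.
move=> ii jj vv [] [z [c [zi cc call vc]]]; [left|right]; exists z, c; split => //.
- exact: leq_trans ii.
- apply: sub_all call => e /andP[/andP[-> ei] ej] /=.
  by rewrite (leq_trans ei ii) (leq_trans ej jj).
- exact: leq_trans vc.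
- exact: leq_trans jj.
- apply: sub_all call => e /andP[ei /andP[-> ej]] /=.
  by rewrite (leq_trans ei ii) (leq_trans ej jj).
- exact: leq_trans vc.
Qed.

Lemma chain_rcons c i j : chain c -> all (fun e => (e.1 < i) && (e.2 < j)) c ->
  occupied (i, j) -> chain (rcons c (i, j)).
Proof.
move=> /andP[sc pc] ac pij; rewrite /chain all_rcons pc pij !andbT.
by rewrite (sorted_pairwise below_trans) pairwise_rcons -(sorted_pairwise below_trans) sc andbT.
Qed.

Lemma exits_point i j v : occupied (i, j) -> exits i j v -> exits i.+1 j.+1 v.+1.
Proof.
move=> pij [] [z [c [zi cc call vc]]]; [left|right]; exists z, (rcons c (i, j)); split.
- exact: leqW.
- by apply: chain_rcons => //; apply: sub_all call => e /andP[/andP[_ ->]].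
- rewrite all_rcons /= zi !ltnS !leqnn /=; apply: sub_all call => e /andP[/andP[-> ei] ej] /=.
  by rewrite !ltnS (ltnW ei) (ltnW ej).
- by rewrite size_rcons addnS ltnS.
- exact: leqW.
- by apply: chain_rcons => //; apply: sub_all call => e /andP[-> /andP[_]].
- rewrite all_rcons /= zi !ltnS !leqnn /=; apply: sub_all call => e /andP[ei /andP[-> ej]] /=.
  by rewrite !ltnS (ltnW ei) (ltnW ej).
- by rewrite size_rcons addnS ltnS.
Qed.

Lemma exits_bottom i : exits i 0 (count id (take i S)).
Proof. by left; exists i, [::]; rewrite addn0. Qed.

Lemma exits_left j : exits 0 j (count id (take j T)).
Proof. by right; exists j, [::]; rewrite addn0. Qed.

Lemma exits_row xs j a : j < size T -> size xs = a -> size (nth [::] w j) = a ->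
  (forall i, i <= a -> exits i j (count id (take j T) + count id (take i xs))) ->
  forall i, i <= a -> exits i j.+1
    (count id (take j.+1 T) + count id (take i (rowstep (nth false T j) xs (nth [::] w j)))).
Proof.
move=> jT sx sw H; have -> : count id (take j.+1 T) = count id (take j T) + nth false T j.
  by rewrite (take_nth false)// -cats1 count_cat /= addn0.
elim=> [|i IH] ia.
  rewrite take0 addn0 -[X in exits _ _ X](_ : count id (take j.+1 T) = _); first exact: exits_left.
  by rewrite (take_nth false)// -cats1 count_cat /= addn0.
rewrite -addnA rowstep_max ?sx ?sw//.
set U := nth false T j + _; set L1 := count id (take i.+1 xs); set L0 := count id (take i xs).
have Ui := IH (ltnW ia); rewrite -addnA -/U in Ui.
case: (leqP U (maxn L1 (L0 + nth false (nth [::] w j) i))) => [h|/ltnW h]; last first.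
  exact: exits_mono Ui.
case: (leqP L1 (L0 + nth false (nth [::] w j) i)) => [h'|/ltnW h']; last first.
  exact: exits_mono (H _ ia).
case: (boolP (nth false (nth [::] w j) i)) => [pij|_].
  by rewrite addn1 addnS; apply: exits_point => //; apply: H; exact: ltnW.
by apply: exits_mono (H _ (ltnW ia)); rewrite ?addn0.
Qed.

(** The last-passage function at the far corner is the sum of the increments on the
    left side and on the upper side. *)
Lemma exits_profile a : size S = a -> size T = size w -> all (fun r => size r == a) w ->
  exits a (size w) (count id T + count id (profile S T w)).
Proof.
move=> sS sTw /allP wa.
have key n j xs : j + n = size w -> size xs = a ->
   (forall i, i <= a -> exits i j (count id (take j T) + count id (take i xs))) ->
   exits a (size w) (count id T + count id (profile xs (drop j T) (drop j w))).
  elim: n j xs => [|n IH] j xs jn sx H.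
    have := H a (leqnn a); rewrite addn0 in jn.
    rewrite (@take_oversize _ j T) ?(@take_oversize _ a xs) ?sTw ?sx ?jn//.
    by rewrite !drop_oversize ?sTw ?jn.
  have jw : j < size w by rewrite -jn addnS ltnS leq_addr.
  have jT : j < size T by rewrite sTw.
  rewrite (drop_nth false jT) (drop_nth [::] jw) /=.
  have sj : size (nth [::] w j) = a by apply/eqP/wa; rewrite mem_nth.
  apply: IH; first by rewrite addSnnS.
    by rewrite size_rowstep// sx sj.
  exact: exits_row.
have := key (size w) 0 S (add0n _) sS; rewrite !drop0; apply => i _.
rewrite take0 add0n; exact: exits_bottom.
Qed.

End Exit.

(** * Longest chains of grid points *)

Definition maxchain w := \max_(n < (size w).+1 | `[< exists c, chain w c /\ size c = n >]) n.

Lemma chain_rows w c : chain w c -> sorted ltn [seq e.2 | e <- c].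
Proof.
by move=> /andP[sc _]; rewrite sorted_map; apply: sub_sorted sc => e f /andP[].
Qed.

Lemma increasing_uniq (s : seq nat) : sorted ltn s -> uniq s.
Proof. by move=> ss; apply: sorted_uniq ss; [exact: ltn_trans|exact: ltnn]. Qed.

Lemma point_row w e : occupied w e -> e.2 < size w.
Proof. by apply: contraTT; rewrite -leqNgt /occupied => h; rewrite (nth_default [::] h) nth_nil. Qed.

Lemma chain_size w c : chain w c -> size c <= size w.
Proof.
move=> cc; rewrite -(size_map snd) -[X in _ <= X](size_iota 0).
apply: uniq_leq_size; first exact: increasing_uniq (chain_rows cc).
move=> _ /mapP[e ec ->]; rewrite mem_iota /= add0n; apply: point_row.
by case/andP: cc => _ /allP/(_ _ ec).
Qed.

Lemma maxchain_ge w c : chain w c -> size c <= maxchain w.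
Proof.
move=> cc; have sc : size c < (size w).+1 by rewrite ltnS chain_size.
rewrite /maxchain; apply: (@leq_bigmax_cond _ (fun n : 'I_(size w).+1 =>
  `[< exists c, chain w c /\ size c = n >]) (fun n => val n) (Ordinal sc)).
by apply/asboolP; exists c.
Qed.

Lemma maxchain_ex w : exists2 c, chain w c & size c = maxchain w.
Proof.
pose P := [pred n : 'I_(size w).+1 | `[< exists c, chain w c /\ size c = n >]].
have P0 : 0 < #|P|.
  by apply/card_gt0P; exists ord0; apply/asboolP; exists [::].
have [n /asboolP[c [cc cn]] e] := eq_bigmax_cond (fun n : 'I_(size w).+1 => val n) P0.
by exists c => //; rewrite cn -e.
Qed.

Lemma chain_filter w c (P : pred (nat * nat)) : chain w c -> chain w [seq e <- c | P e].
Proof.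
move=> /andP[sc pc]; apply/andP; split; first exact: sorted_filter below_trans _ _ sc.
by rewrite all_filter; apply: sub_all pc => e /= ->; rewrite implybT.
Qed.

(** A strict chain has at most one point in each row. *)
Lemma maxchain_lipschitz w1 w2 r r' :
  maxchain (w1 ++ r :: w2) <= maxchain (w1 ++ r' :: w2) + 1.
Proof.
have [c cc <-] := maxchain_ex (w1 ++ r :: w2).
rewrite -(count_predC (fun e => e.2 != size w1) c) leq_add//.
  rewrite -size_filter; apply: maxchain_ge.
  have /andP[sc pc] := chain_filter (fun e => e.2 != size w1) cc.
  rewrite /chain sc /=; apply/allP => e ec; have := allP pc e ec.
  move: ec; rewrite mem_filter => /andP[e2 _]; rewrite /occupied !nth_cat.
  case: ltnP => // le; rewrite -(subnKC le) addKn; case: (e.2 - size w1) (subnKC le) => //.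
  by rewrite addn0 => e2'; rewrite e2' eqxx in e2.
rewrite (eq_count (a2 := preim snd (pred1 (size w1)))); last by move=> e /=; rewrite negbK.
rewrite -count_map count_uniq_mem ?leq_b1//.
exact: increasing_uniq (chain_rows cc).
Qed.

Lemma chain_shift_cols w c m : chain w c -> all (fun e => m <= e.1) c ->
  size c <= maxchain (map (drop m) w).
Proof.
move=> /andP[sc pc] mc; pose f (e : nat * nat) := (e.1 - m, e.2).
rewrite -(size_map f); apply: maxchain_ge; apply/andP; split.
  rewrite sorted_map; apply: sub_in_sorted mc sc => e g me mg /andP[eg1 eg2].
  by rewrite /below /= eg2 ltn_sub2r// (leq_ltn_trans me).
apply/allP => _ /mapP[e ec ->]; have := allP pc e ec; have := allP mc e ec => me pe.
by rewrite /occupied (nth_map [::]) ?(point_row pe)//= nth_drop subnKC.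
Qed.

Lemma chain_shift_rows w c m : chain w c -> all (fun e => m <= e.2) c ->
  size c <= maxchain (drop m w).
Proof.
move=> /andP[sc pc] mc; pose f (e : nat * nat) := (e.1, e.2 - m).
rewrite -(size_map f); apply: maxchain_ge; apply/andP; split.
  rewrite sorted_map; apply: sub_in_sorted mc sc => e g me mg /andP[eg1 eg2].
  by rewrite /below /= eg1 ltn_sub2r// (leq_ltn_trans me).
apply/allP => _ /mapP[e ec ->]; have := allP pc e ec; have := allP mc e ec => me pe.
by rewrite /occupied /= nth_drop subnKC.
Qed.

Lemma count_take_le (s : seq bool) m n : m <= n -> count id (take m s) <= count id (take n s).
Proof.
by move=> mn; rewrite -(take_takel s mn) -[X in _ <= count _ X](cat_take_drop m) count_cat leq_addr.
Qed.

(** Rounding the exit down to a multiple of [u] or [t] enlarges the rectangle of the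
    chain, and rounding it up for the sources and sinks adds some of these. This leaves
    a bounded number of exits to compare. *)
Lemma exits_maxchain S T w a b v u t : 0 < u -> 0 < t -> exits S T w a b v ->
  (exists2 j, j * u <= a & v <= count id (take (j.+1 * u) S) + maxchain (map (drop (j * u)) w)) \/
  (exists2 j, j * t <= b & v <= count id (take (j.+1 * t) T) + maxchain (drop (j * t) w)).
Proof.
move=> u0 t0 [] [z [c [zi cc call vc]]]; [left; exists (z %/ u)|right; exists (z %/ t)].
- exact: leq_trans (leq_trunc_div _ _) zi.
- apply: leq_trans vc _; apply: leq_add; first by rewrite count_take_le// ltnW// ltn_ceil.
  apply: chain_shift_cols => //; apply: sub_all call => e /andP[/andP[ze _] _].
  exact: leq_trans (leq_trunc_div _ _) ze.
- exact: leq_trans (leq_trunc_div _ _) zi.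
- apply: leq_trans vc _; apply: leq_add; first by rewrite count_take_le// ltnW// ltn_ceil.
  apply: chain_shift_rows => //; apply: sub_all call => e /andP[_ /andP[ze _]].
  exact: leq_trans (leq_trunc_div _ _) ze.
Qed.

Lemma find_count1 (T : Type) (P : pred T) x0 s i : count P s = 1 -> i < size s ->
  P (nth x0 s i) -> find P s = i.
Proof.
elim: s i => [//|x s IH] [|i] /=; first by case: (P x).
case: (boolP (P x)) => Px /=; last by rewrite add0n ltnS => c1 si Pi; rewrite (IH i).
rewrite add1n => -[c0] si Pi.
have : has P s by apply/(has_nthP x0); exists i.
by rewrite has_count c0.
Qed.

Definition colcount (w : seq (seq bool)) c := count (fun r => nth false r c) w.

Definition colperm a (s : 'S_a) (r : seq bool) := [seq nth false r (s i) | i <- enum 'I_a].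

Section Comparison.
Variable A : set (seq nat).
Hypotheses (A0 : A [::]) (A1 : A [:: 1]) (sumA : sum_closed A).

(** When column [c] has a single point, this label refines the order of the rows of
    such points and breaks ties by the column. *)
Definition label a (w : seq (seq bool)) (c : 'I_a) := find (fun r => nth false r c) w * a + c.

Lemma label_inj a w : injective (@label a w).
Proof.
move=> c c' /(congr1 (modn^~ a)); rewrite /label !modnMDl !modn_small// => e; exact: val_inj.
Qed.

(** A chain has at most one point in each column. Its points in columns with a single
    point have increasing labels, hence an increasing pattern, which is in the class. *)
Lemma maxchain_colperm a (w : seq (seq bool)) (s : 'S_a) :
  maxchain (map (colperm s) w) <= #|[set c : 'I_a | 1 < colcount w c]| +
    longest A [seq label w (s i) | i <- enum 'I_a &
      (i \in [set: 'I_a]) && (s i \in [set c : 'I_a | colcount w c == 1])].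
Proof.
have [c cc <-] := maxchain_ex (map (colperm s) w).
have pt e : e \in c -> e.2 < size w /\ exists2 i : 'I_a, e.1 = i & nth false (nth [::] w e.2) (s i).
  move=> ec; have := allP (andP cc).2 e ec => pe; have := point_row pe; rewrite size_map => e2.
  split => //; move: pe; rewrite /occupied (nth_map [::])// /colperm.
  have [ea|ea] := ltnP e.1 a; last by rewrite nth_default// size_map size_enum_ord.
  by rewrite (nth_map (Ordinal ea)) ?size_enum_ord// (nth_ord_enum _ (Ordinal ea)) => h; exists (Ordinal ea).
case: c cc pt => [//|e0 c0]; set c := e0 :: c0 => cc pt.
have [_ [i0 _ _]] := pt e0 (mem_head _ _).
pose f (e : nat * nat) : 'I_a := insubd i0 e.1.
have fE e : e \in c -> f e = e.1 :> nat /\ nth false (nth [::] w e.2) (s (f e)).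
  move=> /pt[_ [i ei pi]]; have -> : f e = i by apply: val_inj; rewrite val_insubd ei ltn_ord.
  by split.
have fsorted c' : subseq c' c -> sorted (fun i j : 'I_a => i < j) (map f c').
  move=> sub; have all_c' : all (fun e => e \in c) c' by apply/allP => e; apply: mem_subseq.
  rewrite sorted_map; apply: sub_in_sorted all_c' (subseq_sorted below_trans sub (andP cc).1).
  by move=> e g ec gc /andP[eg _] /=; rewrite (fE e ec).1 (fE g gc).1.
have cnt1 e : e \in c -> 0 < colcount w (s (f e)).
  move=> ec; rewrite -has_count; apply/(has_nthP [::]); exists e.2; first by case: (pt e ec).
  by case: (fE e ec).
pose P e := colcount w (s (f e)) == 1.
rewrite -(count_predC P) addnC leq_add//.
  have u : uniq [seq s (f e) | e <- c & predC P e].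
    rewrite (map_comp s f) map_inj_uniq; last exact: perm_inj.
    have := fsorted _ (filter_subseq (predC P) c); apply: sorted_uniq.
      by move=> y x z; apply: ltn_trans.
    by move=> x; apply: ltnn.
  rewrite -size_filter -(size_map (fun e => s (f e))) -(card_uniqP u).
  apply: subset_leq_card; apply/fintype.subsetP => _ /mapP[e + ->].
  rewrite mem_filter => /andP[/= P1 /cnt1]; rewrite inE.
  by move: P1; rewrite /P; move: (colcount _ _) => [|[]].
have sub1 := filter_subseq P c; set c1 := [seq e <- c | P e] in sub1 *.
rewrite -size_filter -/c1 -(size_map (fun e => label w (s (f e)))).
apply: longest_ge.
  rewrite (map_comp (fun i => label w (s i)) f); apply: map_subseq.
  apply: subseq_enum_ord; first exact: fsorted.
  by apply/allP => _ /mapP[e + ->]; rewrite mem_filter !inE => /andP[].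
suff sl : sorted ltn [seq label w (s (f e)) | e <- c1].
  by rewrite pattern_of_sorted//; exact: iota_in.
have all_c1 : all (fun e => (e \in c) && P e) c1.
  by apply/allP => e; rewrite mem_filter andbC.
rewrite sorted_map; apply: sub_in_sorted all_c1 (subseq_sorted below_trans sub1 (andP cc).1).
have lE e : (e \in c) && P e -> label w (s (f e)) = e.2 * a + s (f e).
  move=> /andP[ec /eqP Pe]; rewrite /label; congr (_ * _ + _).
  by apply: (find_count1 (x0 := [::]) Pe); [case: (pt e ec)|case: (fE e ec)].
move=> e g he hg /andP[_ eg] /=; rewrite !lE//.
apply: (@leq_trans (e.2.+1 * a)); first by rewrite mulSn addnC ltn_add2r.
by apply: leq_trans (leq_addr _ _); rewrite leq_mul2r eg orbT.
Qed.

End Comparison.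

(** * The constant of increasing subsequences *)

Local Open Scope ring_scope.

Section LowerBound.
Variables (R : realType) (A : set (seq nat)).
Hypotheses (A0 : A [::]) (A1 : A [:: 1]) (sumA : sum_closed A).

Lemma mean_colcount (p : R) a b (c : 'I_a) h : 0 <= p <= 1 ->
  mean (iid (iid (bern p) a) b) (fun w => h (colcount w c)) =
  mean (iid (bern p) b) (fun s => h (count id s)).
Proof.
move=> p01; rewrite -(@mean_iid_map _ _ (iid (bern p) a) _ _ (fun r : seq bool => nth false r c)); last first.
  by move=> g; apply: mean_iid_nth => //; exact: prob_bern.
by apply: eq_mean => w; rewrite count_map.
Qed.

Variables (kappa C : R).
Hypothesis kappa_gt0 : 0 < kappa.
Hypothesis fle : forall n, expect R A n <= kappa * Num.sqrt n%:R + C.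

Lemma expect_le_linear n q : 0 < q -> expect R A n <= kappa * ((n%:R / q + q) / 2) + C.
Proof.
move=> q0; apply: le_trans (fle n) _; rewrite lerD2r ler_wpM2l ?(ltW kappa_gt0)//.
rewrite -[X in X / q](sqr_sqrtr (ler0n R n)); set r := Num.sqrt _.
rewrite -subr_ge0 (_ : _ - _ = (r - q) ^+ 2 / (2 * q)); last by field; rewrite gt_eqF.
by rewrite mulr_ge0 ?sqr_ge0// invr_ge0 mulr_ge0// ltW.
Qed.

(** The words of labels are uniformly permuted, so that [sum_restrict_box] applies. The
    number of columns with several points is at most the sum of [m ^ 2 - m] over the
    column counts [m]. *)
Lemma maxchain_average a (w : seq (seq bool)) q : 0 < q ->
  \sum_(s : 'S_a) (maxchain (map (colperm s) w))%:R <=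
  a`!%:R * (\sum_(c < a) ((colcount w c)%:R ^+ 2 - (colcount w c)%:R) +
    (kappa * (((\sum_(c < a) (colcount w c)%:R) / q + q) / 2) + C)).
Proof.
move=> q0; pose G := [set c : 'I_a | colcount w c == 1%N].
apply: le_trans (_ : \sum_(s : 'S_a) ((#|[set c : 'I_a | (1 < colcount w c)%N]|)%:R +
  lenA R A [seq label w (s i) | i <- enum 'I_a & (i \in [set: 'I_a]) && (s i \in G)]) <= _).
  by apply: ler_sum => s _; rewrite -natrD ler_nat; exact: maxchain_colperm.
rewrite big_split /= (sum_restrict_box (lenA_invariant R A0) [set: 'I_a] G (@label_inj a w)).
rewrite [X in _ + X <= _](eq_bigr (fun=> expect R A #|G|)); last first.
  move=> s _; suff -> : boxcount [set: 'I_a] G s = #|G| by [].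
  rewrite /boxcount -(card_imset _ (@perm_inj _ s)); apply: eq_card => c; apply/imsetP/idP.
    by case=> i; rewrite inE => /andP[_ iG] ->.
  move=> cG; exists (s^-1 c)%g; last by rewrite permKV.
  by rewrite inE permKV cG andbT inE.
have sum_const (x : R) : \sum_(s : 'S_a) x = a`!%:R * x by rewrite sumr_const card_Sn mulr_natl.
rewrite !sum_const -mulrDr ler_wpM2l// lerD//.
  rewrite -sum1_card natr_sum big_mkcond; apply: ler_sum => c _; rewrite inE.
  case: (colcount w c) => [|[|m]] /=; rewrite ?expr0n ?expr1n ?subrr//.
  rewrite -natrX -natrB ?ler1n; last by rewrite expnS expn1 leq_pmulr.
  by rewrite expnS expn1 mulSn; lia.
apply: le_trans (expect_le_linear #|G| q0) _; rewrite lerD2r ler_wpM2l ?(ltW kappa_gt0)//.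
rewrite ler_wpM2r// lerD2r ler_wpM2r ?invr_ge0 ?(ltW q0)//.
rewrite -sum1_card natr_sum big_mkcond; apply: ler_sum => c _; rewrite inE.
by case: eqP => [->|].
Qed.

(** Comparison with random permutations: the columns are exchangeable, the number of
    points has mean [a * b * p], and [sqrt n <= (n / q + q) / 2] makes the bound on
    [expect] linear in that number. The last term bounds the mean number of columns
    with several points. *)
Lemma mean_maxchain (p : R) a b q : 0 <= p <= 1 -> 0 < q ->
  mean (iid (iid (bern p) a) b) (fun w => (maxchain w)%:R) <=
  kappa * (((a%:R * b%:R * p) / q + q) / 2) + C + a%:R * (b%:R * p) ^+ 2.
Proof.
move=> p01 q0; have pb := prob_bern p01.
have pr : prob (iid (bern p) a) by exact: prob_iid.
have pw : prob (iid (iid (bern p) a) b) by exact: prob_iid.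
have fa : 0 < a`!%:R :> R by rewrite ltr0n fact_gt0.
rewrite -(ler_pM2l fa).
apply: le_trans (_ : mean (iid (iid (bern p) a) b)
  (fun w => \sum_(s : 'S_a) (maxchain (map (colperm s) w))%:R) <= _).
  rewrite mean_sum (eq_bigr (fun=> mean (iid (iid (bern p) a) b) (fun w => (maxchain w)%:R))).
    by rewrite sumr_const card_Sn mulr_natl.
  move=> s _; rewrite (@mean_iid_map _ _ (iid (bern p) a) _ (iid (bern p) a) (colperm s) b (fun w => (maxchain w)%:R))//.
  by move=> g; exact: mean_iid_perm.
apply: le_trans (mean_le pw (fun w => maxchain_average a w q0)) _.
rewrite meanZ ler_wpM2l ?(ltW fa)// meanD mean_sum.
rewrite [X in X + _ <= _](_ : _ = a%:R * (b%:R * (p * (1 - p)) + (b%:R * p) ^+ 2 - b%:R * p)); last first.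
  rewrite (eq_bigr (fun=> b%:R * (p * (1 - p)) + (b%:R * p) ^+ 2 - b%:R * p)).
    by rewrite sumr_const card_ord [RHS]mulr_natl.
  move=> c _; rewrite (mean_colcount _ _ (fun m => m%:R ^+ 2 - m%:R))//.
  under eq_mean => s.
    rewrite (_ : (count id s)%:R ^+ 2 - (count id s)%:R = ((count id s)%:R - b%:R * p) ^+ 2 +
       ((2 * (b%:R * p) - 1) * (count id s)%:R + - (b%:R * p) ^+ 2)); last by ring.
    over.
  rewrite !meanD meanZ meanC ?mean_count ?mean_count_var//; last exact: prob_iid.
  by ring.
rewrite [X in _ + X <= _](_ : _ = kappa * (((a%:R * b%:R * p) / q + q) / 2) + C); last first.
  under eq_mean => w.
    rewrite (_ : kappa * _ + C = kappa / (2 * q) * (\sum_(c < a) (colcount w c)%:R) + (kappa * q / 2 + C)).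
      over.
    by field; rewrite gt_eqF.
  rewrite meanD meanZ meanC// mean_sum (eq_bigr (fun=> b%:R * p)) => [|c _]; last first.
    by rewrite (mean_colcount _ _ (fun m => m%:R))// mean_count.
  by rewrite sumr_const card_ord -[_ *+ _]mulr_natl; field; rewrite gt_eqF.
rewrite addrC lerD2l ler_wpM2l// -subr_ge0.
rewrite (_ : _ - _ = b%:R * p ^+ 2); last by ring.
by rewrite mulr_ge0 ?exprn_ge0//; case/andP: p01.
Qed.

End LowerBound.

Lemma mean_var_add (R : realType) T (d : seq (R * T)) (Y Z : T -> R) v w : prob d ->
  mean d (fun x => (Y x - mean d Y) ^+ 2) <= v -> mean d (fun x => (Z x - mean d Z) ^+ 2) <= w ->
  mean d (fun x => (Y x + Z x - mean d (fun x => Y x + Z x)) ^+ 2) <= 2 * (v + w).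
Proof.
move=> pd hv hw; rewrite meanD.
apply: le_trans (_ : mean d (fun x => 2 * ((Y x - mean d Y) ^+ 2 + (Z x - mean d Z) ^+ 2)) <= _).
  apply: mean_le => // x; set y := mean d Y; set z := mean d Z.
  rewrite -subr_ge0 (_ : _ - _ = ((Y x - y) - (Z x - z)) ^+ 2); last by ring.
  exact: sqr_ge0.
by rewrite meanZ meanD ler_wpM2l// lerD.
Qed.

Section Hammersley.
Variables (R : realType) (al be p : R) (K u t : nat).
Hypotheses (al01 : 0 <= al <= 1) (be01 : 0 <= be <= 1) (p01 : 0 <= p <= 1).
Hypothesis balance : al * be = p * (1 - al) * (1 - be).
Hypotheses (u0 : (0 < u)%N) (t0 : (0 < t)%N).

Let a := (K * u)%N.
Let b := (K * t)%N.
Let dS := iid (bern al) a.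
Let dT := iid (bern be) b.
Let grid n m : seq (R * seq (seq bool)) := iid (iid (bern p) n) m.
Let dO := prod (prod dS dT) (grid a b).

Let pS : prob dS. Proof. exact/prob_iid/prob_bern. Qed.
Let pT : prob dT. Proof. exact/prob_iid/prob_bern. Qed.
Let pG n m : prob (grid n m). Proof. exact/prob_iid/prob_iid/prob_bern. Qed.
Let pST : prob (prod dS dT). Proof. exact: prob_prod. Qed.
Let pO : prob dO. Proof. exact: prob_prod. Qed.

Let total_length (z : seq bool * seq bool * seq (seq bool)) : R :=
  (count id z.1.2 + count id (profile z.1.1 z.1.2 z.2))%:R.

Lemma mean_stationary : mean dO total_length = b%:R * be + a%:R * al.
Proof.
rewrite /total_length; under eq_mean do rewrite natrD.
rewrite meanD (mean_fst _ (fun z => (count id z.2)%:R) (pG a b)) (mean_snd _ (fun s => (count id s)%:R))//.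
rewrite mean_count// !mean_prod/=; congr (_ + _).
rewrite (profile_stationary balance a b (fun s => (count id s)%:R)); exact: mean_count.
Qed.

Lemma mean_take_count (q : R) m n : 0 <= q <= 1 ->
  mean (iid (bern q) n) (fun s => (count id (take m s))%:R) = (minn m n)%:R * q.
Proof.
move=> q01; rewrite (mean_iid_take _ _ (fun s => (count id s)%:R)) ?mean_count//.
exact: prob_bern.
Qed.

Lemma mean_take_var (q : R) m n : 0 <= q <= 1 ->
  mean (iid (bern q) n) (fun s => ((count id (take m s))%:R - (minn m n)%:R * q) ^+ 2) <= n%:R * q.
Proof.
move=> q01; have [q0 q1] := andP q01.
rewrite (mean_iid_take _ _ (fun s => ((count id s)%:R - _) ^+ 2)); last exact: prob_bern.
rewrite mean_count_var//; apply: ler_pM; rewrite ?ler_nat ?geq_minr//.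
  by rewrite mulr_ge0// subr_ge0.
by rewrite ler_piMr// gerBl.
Qed.

Lemma maxchain_var n m : mean (grid n m) (fun w =>
  ((maxchain w)%:R - mean (grid n m) (fun w => (maxchain w)%:R)) ^+ 2) <= m%:R.
Proof.
apply: mean_iid_lipschitz; first exact/prob_iid/prob_bern.
by move=> w1 w2 r r'; rewrite -[X in _ + X]/(1%:R) -natrD ler_nat maxchain_lipschitz.
Qed.

Lemma mean_cols (h : seq (seq bool) -> R) m :
  mean (grid a b) (fun w => h (map (drop m) w)) = mean (grid (a - m) b) h.
Proof.
rewrite (@mean_iid_map _ _ _ _ (iid (bern p) (a - m)))// => g.
exact/mean_iid_drop/prob_bern.
Qed.

Lemma mean_rows (h : seq (seq bool) -> R) m :
  mean (grid a b) (fun w => h (drop m w)) = mean (grid a (b - m)) h.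
Proof. exact/mean_iid_drop/prob_iid/prob_bern. Qed.

(** The exact mean on the left is at most the mean of the maximum over the exits.
    The variance of the longest chain is at most the number of rows
    ([maxchain_lipschitz]), and [v] bounds the variances of the lengths of all exits. *)
Lemma exit_bound M v q : 0 < q ->
  (forall j, (j <= K)%N -> (minn (j.+1 * u) a)%:R * al +
     mean (grid (a - j * u) b) (fun w => (maxchain w)%:R) <= M) ->
  (forall j, (j <= K)%N -> (minn (j.+1 * t) b)%:R * be +
     mean (grid a (b - j * t)) (fun w => (maxchain w)%:R) <= M) ->
  2 * (a%:R * al + b%:R) <= v -> 2 * (b%:R * be + b%:R) <= v ->
  b%:R * be + a%:R * al <= M + (q + (2 * K.+1)%:R * v / q) / 2.
Proof.
move=> q0 H1 H2 v1 v2; rewrite -mean_stationary.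
pose Y (i : bool * 'I_K.+1) (z : seq bool * seq bool * seq (seq bool)) : R :=
  if i.1 then (count id (take (i.2.+1 * u) z.1.1))%:R + (maxchain (map (drop (i.2 * u)) z.2))%:R
  else (count id (take (i.2.+1 * t) z.1.2))%:R + (maxchain (drop (i.2 * t) z.2))%:R.
have cI : #|{: bool * 'I_K.+1}| = (2 * K.+1)%N by rewrite card_prod card_bool card_ord.
rewrite -cI.
have supO : supp dO (fun z => [&& size z.1.1 == a, size z.1.2 == b, size z.2 == b &
    all (fun r => size r == a) z.2]).
  have sb T (d : seq (R * T)) n : supp (iid d n) (fun s => size s == n).
    apply: sub_all (supp_iid (P := predT) n _) => [e /andP[]//|].
    by rewrite /supp all_predT.
  have := supp_prod (supp_prod (sb _ (bern al) a) (sb _ (bern be) b)) (supp_iid b (sb _ (bern p) a)).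
  by apply: sub_all => e /= /andP[/andP[-> ->] ->].
have e1S m : mean dO (fun z => (count id (take m z.1.1))%:R) = (minn m a)%:R * al.
  rewrite (mean_fst _ (fun z => (count id (take m z.1))%:R) (pG a b)).
  by rewrite (mean_fst _ (fun s => (count id (take m s))%:R))// mean_take_count.
have e1T m : mean dO (fun z => (count id (take m z.1.2))%:R) = (minn m b)%:R * be.
  rewrite (mean_fst _ (fun z => (count id (take m z.2))%:R) (pG a b)).
  by rewrite (mean_snd _ (fun s => (count id (take m s))%:R))// mean_take_count.
have eG h : mean dO (fun z => h z.2) = mean (grid a b) h by rewrite mean_snd//; exact: prob_prod.
apply: (mean_max (Y := Y) pO supO q0).
- move=> [[xs ys] w] /= /and4P[/eqP sx /eqP sy /eqP sw wa].
  have : exits xs ys w a (size w) (count id ys + count id (profile xs ys w)).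
    by apply: exits_profile => //; rewrite sw.
  move=> /(exits_maxchain u0 t0)[[j ja le]|[j jb le]].
    have jK : (j < K.+1)%N by rewrite ltnS -(leq_pmul2r u0).
    by exists (true, Ordinal jK); rewrite /Y /total_length /= -natrD ler_nat.
  have jK : (j < K.+1)%N by rewrite ltnS -(leq_pmul2r t0) -/b -sw.
  by exists (false, Ordinal jK); rewrite /Y /total_length /= -natrD ler_nat.
- move=> [[] j]; rewrite /Y /= meanD.
    rewrite e1S (eG (fun w => (maxchain (map (drop (j * u)) w))%:R)).
    by rewrite (mean_cols (fun w => (maxchain w)%:R)) H1// -ltnS.
  rewrite e1T (eG (fun w => (maxchain (drop (j * t) w))%:R)).
  by rewrite (mean_rows (fun w => (maxchain w)%:R)) H2// -ltnS.
- move=> [[] j]; rewrite /Y /=; [apply: le_trans v1|apply: le_trans v2]; apply: mean_var_add => //.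
  + rewrite e1S (mean_fst _ (fun z => ((count id (take (j.+1 * u) z.1))%:R - _) ^+ 2) (pG a b)).
    rewrite (mean_fst _ (fun s => ((count id (take (j.+1 * u) s))%:R - _) ^+ 2))//.
    exact: mean_take_var.
  + rewrite (eG (fun w => (maxchain (map (drop (j * u)) w))%:R)) (mean_cols (fun w => (maxchain w)%:R)).
    rewrite (eG (fun w => ((maxchain (map (drop (j * u)) w))%:R - _) ^+ 2)).
    rewrite (mean_cols (fun w => ((maxchain w)%:R - _) ^+ 2)); exact: maxchain_var.
  + rewrite e1T (mean_fst _ (fun z => ((count id (take (j.+1 * t) z.2))%:R - _) ^+ 2) (pG a b)).
    rewrite (mean_snd _ (fun s => ((count id (take (j.+1 * t) s))%:R - _) ^+ 2))//.
    exact: mean_take_var.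
  + rewrite (eG (fun w => (maxchain (drop (j * t) w))%:R)) (mean_rows (fun w => (maxchain w)%:R)).
    rewrite (eG (fun w => ((maxchain (drop (j * t) w))%:R - _) ^+ 2)).
    rewrite (mean_rows (fun w => ((maxchain w)%:R - _) ^+ 2)).
    by apply: le_trans (maxchain_var _ _) _; rewrite ler_nat leq_subr.
Qed.

End Hammersley.

Section Constant.
Variables (R : realType) (A : set (seq nat)).
Hypotheses (A0 : A [::]) (A1 : A [:: 1]) (sumA : sum_closed A).
Variables (kappa C : R).
Hypotheses (kappa_gt0 : 0 < kappa) (C0 : 0 <= C).
Hypothesis fle : forall n, expect R A n <= kappa * Num.sqrt n%:R + C.

(** The proof takes [k ^ 2 + 1] exits on each side of the grid, [a = k ^ 36] columns and
    [b = k ^ 12] rows, [al = k ^ - 28] and [be = k ^ - 4], so that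
    [s = a * al = b * be = k ^ 8]. The number of rows is much larger than [s], which
    makes [be] small, but much smaller than [s ^ 2], which makes the variances
    negligible. The number of columns is so large that columns with several
    points are rare. *)
Lemma hammersley_bound k : (1 < k)%N -> 1 <= kappa ^+ 2 / 4 + (kappa ^+ 2 + C + 11) / k%:R.
Proof.
move=> k1; pose X : R := k%:R; pose x := X^-1.
have X2 : 2 <= X by rewrite ler_nat.
have X0 : 0 < X by lra.
have Xn0 : X != 0 by rewrite gt_eqF.
have x0 : 0 < x by rewrite invr_gt0.
have x2 : x <= 1 / 2 by rewrite div1r lef_pV2 ?posrE.
have xX : x * X = 1 by rewrite mulVf.
pose al := x ^+ 28; pose be := x ^+ 4.
have x1 : x <= 1 by lra.
have al0 : 0 <= al by rewrite exprn_ge0// ltW.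
have be0 : 0 <= be by rewrite exprn_ge0// ltW.
have albe : al <= be by rewrite ler_wiXn2l// ltW.
have x3 : x ^+ 3 <= 1 / 8.
  have x22 : x * x <= 1 / 4 by nra.
  by rewrite !exprS expr0 mulr1; nra.
have bex : be <= x / 8 by rewrite /be exprS; nra.
pose th := ((1 - al) * (1 - be))^-1.
have D0 : 1 - 2 * be <= (1 - al) * (1 - be) by nra.
have D1 : 0 < (1 - al) * (1 - be) by apply: lt_le_trans D0; lra.
have th0 : 0 < th by rewrite invr_gt0.
have thx : th <= 1 + 4 * x.
  rewrite /th invf_ple ?posrE//; last by lra.
  rewrite -[leLHS]div1r ler_pdivrMr; last by lra.
  nra.
have th3 : th <= 3 by lra.
pose p := al * be * th.
have balance : al * be = p * (1 - al) * (1 - be).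
  by rewrite /p /th -mulrA -[_ * _ * (_ * _)]mulrA mulVf ?mulr1// gt_eqF.
have p0 : 0 <= p by rewrite !mulr_ge0// ltW.
have p1 : p <= 1 by rewrite /p; nra.
have p01 : 0 <= p <= 1 by rewrite p0.
have aX : (k ^ 2 * k ^ 34)%:R = X ^+ 36 :> R by rewrite -expnD natrX.
have bX : (k ^ 2 * k ^ 10)%:R = X ^+ 12 :> R by rewrite -expnD natrX.
pose M := X ^+ 8 * (1 + x ^+ 2 + kappa ^+ 2 * th / 4) + C + 1.
have small : X ^+ 36 * (X ^+ 12 * p) ^+ 2 <= 1.
  rewrite (_ : _ * _ = (x ^+ 4) * th ^+ 2); last by rewrite /p /al /be /x; field.
  have : be <= 1 / 16 by lra.
  rewrite -/be; nra.
(* With this [q] the bound of [mean_maxchain] is affine in the exit [j], with the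
   slope that cancels the mean number of sources collected before the exit. *)
pose q := kappa * X ^+ 8 * th / 2.
have q0 : 0 < q by rewrite /q divr_gt0// mulr_gt0// mulr_gt0// exprn_gt0.
have key (a' b' : nat) (j : R) : a'%:R * b'%:R * p = th * (X ^+ 16 - j * X ^+ 14) ->
    a'%:R * (b'%:R * p) ^+ 2 <= 1 ->
  mean (iid (iid (bern p) a') b') (fun w => (maxchain w)%:R) <= M - (j + 1) * X ^+ 6.
Proof.
  move=> abp sm; have := @mean_maxchain R A A0 A1 sumA kappa C kappa_gt0 fle p a' b' q p01 q0. move=> /le_trans; apply.
  rewrite abp (_ : M - _ = kappa * ((th * (X ^+ 16 - j * X ^+ 14) / q + q) / 2) + C + 1) ?lerD2l//.
  by rewrite /M /q /x; field; rewrite !gt_eqF.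
have kk n : (0 < k ^ n)%N by rewrite expn_gt0 (ltnW k1).
have jX j m : (j <= k ^ 2)%N -> (k ^ 2 * k ^ m - j * k ^ m)%:R = X ^+ (m + 2) - j%:R * X ^+ m :> R.
  move=> jk; rewrite natrB ?leq_mul2r ?jk ?orbT// !natrM !natrX -/X; congr (_ - _).
  by rewrite exprD mulrC.
have H := @exit_bound R al be p (k ^ 2) (k ^ 34) (k ^ 10) _ _ _ balance (kk _) (kk _)
   M (2 * (X ^+ 8 + X ^+ 12)) (X ^+ 7) (exprn_gt0 _ X0).
have al1 : 0 <= al <= 1 by rewrite al0; lra.
have be1 : 0 <= be <= 1 by rewrite be0; lra.
have {}H := H al1 be1 p01.
have axX (m j : nat) y n : y = x ^+ m -> (minn (j.+1 * k ^ (m + 6)) n)%:R * y <= (j%:R + 1) * X ^+ 6.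
  move=> ->; apply: le_trans (_ : (j.+1 * k ^ (m + 6))%:R * x ^+ m <= _).
    by rewrite ler_wpM2r ?exprn_ge0 ?(ltW x0)// ler_nat geq_minl.
  rewrite natrM natrX -/X natr1 -mulrA ler_wpM2l// exprD mulrAC -exprMn.
  by rewrite [X * x]mulrC xX expr1n mul1r.
have Q : (X ^+ 7 + (2 * (k ^ 2).+1)%:R * (2 * (X ^+ 8 + X ^+ 12)) / X ^+ 7) / 2 <= 17 / 2 * X ^+ 7.
  have k2 : (2 * (k ^ 2).+1)%:R = 2 * (X ^+ 2 + 1) :> R by rewrite natrM; congr (_ * _); rewrite -natr1 natrX.
  rewrite k2 ler_pdivrMr// (_ : 17 / 2 * X ^+ 7 * 2 = X ^+ 7 + 16 * X ^+ 7); last by field.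
  rewrite lerD2l ler_pdivrMr ?exprn_gt0//.
  have X2' : X ^+ 2 + 1 <= 2 * X ^+ 2 by nra.
  have X12 : X ^+ 8 + X ^+ 12 <= 2 * X ^+ 12.
    by rewrite mulr_natl mulr2n lerD2r ler_weXn2l//; lra.
  rewrite (_ : 16 * X ^+ 7 * X ^+ 7 = (2 * (2 * X ^+ 2)) * (2 * (2 * X ^+ 12))); last by ring.
  have Xp n : 0 <= X ^+ n by rewrite exprn_ge0// ltW.
  by apply: ler_pM; rewrite ?mulr_ge0 ?addr_ge0// ler_wpM2l.
have L : X ^+ 12 * be + X ^+ 36 * al = 2 * X ^+ 8.
  by rewrite /be /al /x; field.
have {}H : 2 * X ^+ 8 <= M + 17 / 2 * X ^+ 7.
  rewrite -L -aX -bX; apply: le_trans (H _ _ _ _) _; last by rewrite lerD2l.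
  - move=> j jk; rewrite -lerBrDl; apply: le_trans (key _ _ j%:R _ _) _.
    + rewrite bX jX// /p /al /be /x; field => //.
    + apply: le_trans small; rewrite bX -aX ler_wpM2r ?sqr_ge0// ler_nat leq_subr//.
    + by rewrite lerD2l lerN2; exact: (axX 28).
  - move=> j jk; rewrite -lerBrDl; apply: le_trans (key _ _ j%:R _ _) _.
    + rewrite aX jX// /p /al /be /x; field => //.
    + apply: le_trans small; rewrite aX -bX ler_wpM2l ?exprn_ge0 ?(ltW X0)//.
      apply: lerXn2r; [by rewrite nnegrE mulr_ge0|by rewrite nnegrE mulr_ge0|].
      by rewrite ler_wpM2r// ler_nat leq_subr.
    + by rewrite lerD2l lerN2; exact: (axX 4).
  - rewrite aX bX ler_wpM2l// lerD2r (_ : _ * _ = X ^+ 8)//.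
    by rewrite /al /x; field.
  - rewrite bX ler_wpM2l// lerD2r (_ : _ * _ = X ^+ 8)//.
    by rewrite /be /x; field.
have x80 : 0 < x ^+ 8 by rewrite exprn_gt0.
have : 2 <= 1 + x ^+ 2 + kappa ^+ 2 * th / 4 + (C + 1) * x ^+ 8 + 17 / 2 * x.
  have := H; rewrite -(ler_pM2l x80) (_ : x ^+ 8 * (2 * _) = 2); last by rewrite /x; field.
  by move/le_trans; apply; rewrite le_eqVlt; apply/orP; left; apply/eqP; rewrite /M /x; field.
have xx : x ^+ 2 <= x by nra.
have xx8 : x ^+ 8 <= x by rewrite exprS ler_piMr ?(ltW x0)// exprn_ile1// ltW.
have ka2 : 0 <= kappa ^+ 2 by rewrite sqr_ge0.
have : kappa ^+ 2 * th <= kappa ^+ 2 * (1 + 4 * x) by rewrite ler_wpM2l.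
have : (C + 1) * x ^+ 8 <= (C + 1) * x by rewrite ler_wpM2l// addr_ge0.
rewrite -/X -/x; lra.
Qed.

(** The bound of [hammersley_bound] tends to [kappa ^ 2 / 4]. *)
Lemma constant_ge2 : 2 <= kappa.
Proof.
rewrite leNgt; apply/negP => ka2; pose d := 1 - kappa ^+ 2 / 4.
have d0 : 0 < d.
  have : 0 < (2 - kappa) * (2 + kappa) by rewrite mulr_gt0//; have := kappa_gt0; lra.
  by rewrite /d; lra.
pose c := kappa ^+ 2 + C + 11.
have c0 : 0 < c by rewrite /c ltr_wpDl// addr_ge0// sqr_ge0.
have B := archi_boundP (ltW (divr_gt0 c0 d0)).
have k1 : (1 < (Num.bound (c / d)).+2)%N by [].
have := hammersley_bound k1; rewrite -/c -lerBlDl -/d leNgt => /negP; apply.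
rewrite ltr_pdivrMr ?ltr0n// mulrC -ltr_pdivrMr//; apply: lt_trans B _.
by rewrite ltr_nat.
Qed.
End Constant.

(** * The theorem *)

Local Open Scope classical_set_scope.
Local Open Scope ring_scope.

Lemma uniform_expectation_longest (R : realType) (A : set (seq nat)) n : A [::] ->
  uniform_expectation n (fun s => (longest A s)%:R : R) = expect R A n.
Proof.
move=> A0; rewrite /uniform_expectation /expect /avg size_permutations ?iota_uniq// size_iota.
congr (_ / _); rewrite (perm_big _ (Sn_oneline n)) big_map /= big_enum /=.
by apply: eq_bigr => s _; rewrite -pattern_of_oneline longest_pattern_of.
Qed.

(** The limit [l] satisfies [expect n <= (l + e) * sqrt n + C] for all [e > 0], with a
    constant [C] that takes care of the first terms; hence [l + e >= 2]. *)
Lemma sum_closed_limit (R : realType) (A : set (seq nat)) k (p : 'S_k) :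
  A [::] -> A [:: 1%N] -> sum_closed A ->
  (forall s t : seq nat, A (pattern_of s) -> subseq t s -> A (pattern_of t)) ->
  (forall s, A s -> ~ involved (oneline p) s) ->
  exists c : R, 1 <= c /\
    (fun n : nat =>
       uniform_expectation n (fun pi => (longest A pi)%:R : R)
         / Num.sqrt (n%:R : R)) @ \oo --> 2 * Num.sqrt c.
Proof.
move=> A0 A1 sumA Adown Aavoid.
have [C fC] := expect_sqrt R A0 Adown Aavoid.
have [l l0 lP] := scaled_cvg A0 sumA fC.
have l2 : 2 <= l.
  apply/ler_addgt0Pr => e e0.
  have /cvgrPdist_le/(_ _ e0)[n0 _ n0P] := lP.
  apply: (@constant_ge2 R A A0 A1 sumA (l + e) (expect R A n0)).
  - exact: ltr_wpDl.
  - exact: expect_ge0.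
  - move=> n; have [nn|nn] := leqP n0 n; last first.
      rewrite -[leLHS]add0r lerD ?mulr_ge0 ?addr_ge0 ?sqrtr_ge0 ?(ltW e0)//.
      exact/expect_mono/ltnW.
    have := n0P n nn; rewrite /= ler_distlC => /andP[_ h].
    rewrite -[leLHS]addr0 lerD ?expect_ge0//.
    have [->|n_gt0] := posnP n; last by rewrite -ler_pdivrMr// sqrtr_gt0 ltr0n.
    by have := fC 0%N; rewrite sqrtr0 !mulr0.
exists ((l / 2) ^+ 2); split; first by nra.
rewrite sqrtr_sqr ger0_norm ?divr_ge0// mulrC divfK//.
by under eq_fun do rewrite uniform_expectation_longest//.
Qed.

Lemma involved_pattern_of sigma (s : seq nat) :
  involved sigma (pattern_of s) <-> exists2 t, subseq t s & pattern_of t = sigma.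
Proof.
split=> [[t /subseqP[m sm ->] <-]|[t /subseqP[m sm ->] <-]].
  by exists (mask m s); rewrite ?pattern_of_mask//; exact: mask_subseq.
by exists (mask m (pattern_of s)); rewrite ?pattern_of_mask//; exact: mask_subseq.
Qed.

Lemma Av_down B (s t : seq nat) : Av B (pattern_of s) -> subseq t s -> Av B (pattern_of t).
Proof.
move=> [[n sn] sB] ts; split.
  have us := Sn_uniq sn; have {}us : uniq s by exact: map_uniq us.
  by exists (size t); apply: pattern_of_Sn; exact: subseq_uniq us.
move=> sigma Bs /involved_pattern_of[u ut us]; apply: (sB _ Bs).
by apply/involved_pattern_of; exists u => //; exact: subseq_trans ts.
Qed.

Definition reversal (A : set (seq nat)) : set (seq nat) := [set s | A (rev s)].

Lemma longest_reversal A s : A [::] -> longest (reversal A) s = longest A (rev s).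
Proof.
move=> A0; have A0' : reversal A [::] by [].
apply/eqP; rewrite eqn_leq; apply/andP; split.
  have [t [ts At <-]] := longest_ex A0' s; rewrite -size_rev.
  by apply: longest_ge; rewrite ?subseq_rev// pattern_of_rev.
have [t [ts At <-]] := longest_ex A0 (rev s); rewrite -size_rev.
apply: longest_ge; first by rewrite -(revK s) subseq_rev.
by rewrite /reversal /= -pattern_of_rev revK.
Qed.

Lemma expectation_rev (R : realType) n (g : seq nat -> R) :
  uniform_expectation n (fun s => g (rev s)) = uniform_expectation n g.
Proof.
congr (_ / _); rewrite -(big_map rev xpredT g); apply: perm_big; apply: uniq_perm.
- by rewrite (map_inj_uniq (inv_inj revK)) permutations_uniq.
- exact: permutations_uniq.
move=> s; rewrite -[s in LHS]revK (mem_map (inv_inj revK)) !mem_permutations.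
by rewrite perm_rev.
Qed.

Lemma sum_closed_reversal A : difference_closed A -> sum_closed (reversal A).
Proof.
move=> dA a b Aa Ab; rewrite /reversal /= /direct_sum rev_cat -map_rev.
by have := dA _ _ Ab Aa; rewrite /direct_difference size_rev.
Qed.

Theorem theorem2 (R : realType) (A : set (seq nat))
    (classA : avoidance_class A) (infA : infinite_set A)
    (properA : proper_class A)
    (closedA : sum_closed A \/ difference_closed A) :
  exists c : R, 1 <= c /\
    (fun n : nat =>
       uniform_expectation n (fun pi => (longest A pi)%:R : R)
         / Num.sqrt (n%:R : R)) @ \oo --> 2 * Num.sqrt c.
Proof.
case: classA => B BP AE.
have [sigma Bs] : exists sigma, B sigma.
  apply: contrapT => /forallNP nB; apply: properA; rewrite AE.
  by apply/seteqP; split=> [s []//|s ps]; split=> // sigma /nB.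
have [k /Sn_perm[p sp]] := BP _ Bs.
have Aavoid s : A s -> ~ involved (oneline p) s.
  by rewrite AE -sp => -[_]; apply.
have Adown (s t : seq nat) : A (pattern_of s) -> subseq t s -> A (pattern_of t).
  by rewrite AE; exact: Av_down.
have Ap s : A s -> A (pattern_of s).
  by move=> As; move: (As); rewrite {1}AE => -[[n /pattern_of_id ->]].
have [s As s0] : exists2 s, A s & s != [::].
  apply: contrapT => nA; apply: infA; apply: (sub_finite_set _ (finite_set1 [::])).
  move=> s As; apply: contrapT => /eqP s0; apply: nA; by exists s.
have A0 : A [::] := Adown _ [::] (Ap _ As) (sub0seq _).
have A1 : A [:: 1%N].
  case: s As s0 => // x s As _; have := Adown _ [:: x] (Ap _ As).
  by rewrite /pattern_of /= eqxx sub0seq lexx addn0; apply.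
case: closedA => [sumA|dA]; first exact: sum_closed_limit sumA Adown Aavoid.
have [|q qE] := @Sn_perm k (rev sigma).
  by rewrite mem_permutations perm_rev sp -mem_permutations; exact: oneline_Sn.
have [||c [c1 cP]] := @sum_closed_limit R (reversal A) k q A0 A1 (sum_closed_reversal dA).
- by move=> s' t; rewrite /reversal /= -!pattern_of_rev => As' ts; apply: Adown As' _; rewrite subseq_rev.
- move=> s' As' [t ts te]; apply: (Aavoid _ As'); exists (rev t); first by rewrite subseq_rev.
  by rewrite pattern_of_rev te -qE revK sp.
exists c; split => //; apply: cvg_trans cP; apply: near_eq_cvg; near=> n.
congr (_ / _); rewrite -[RHS]expectation_rev; congr uniform_expectation.
by apply/funext => s'; rewrite longest_reversal.
Unshelve. all: by end_near.
Qed.
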